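(* If $\Sigma$ is a Lefschetz fan, then it also has the mixed HL and mixed HR properties.
   Context: $\Sigma$ is a $d$-dimensional rational simplicial fan in $\mathrm N=\mathbb R\otimes\mathrm N_{\mathbb Z}$; $A(\Sigma)$ is its Chow ring (piecewise polynomials modulo global linear functions). For a cone $\sigma$, $\mathrm{st}_\Sigma(\sigma)$ is the fan in $\mathrm N/\mathrm{span}(\sigma)$ of images of cones containing $\sigma$, with restriction map $\iota_\sigma^*:A(\Sigma)\to A(\mathrm{st}_\Sigma(\sigma))$. $\mathscr K(\Sigma)\subseteq A^1(\Sigma)$ consists of classes $\ell$ such that for every cone $\sigma$ (including $\{0\}$), $\iota_\sigma^*(\ell)$ has a piecewise linear representative positive on all nonzero points of the support of $\mathrm{st}_\Sigma(\sigma)$. $\Sigma$ is Lefschetz if: the $d$-dimensional Minkowski weights are spanned by a positive weight, inducing $\deg:A^d(\Sigma)\cong\mathbb R$; the pairing $A^k\times A^{d-k}\to\mathbb R$ is nondegenerate; for $k\le d/2$ and $\ell\in\mathscr K(\Sigma)$, multiplication by $\ell^{d-2k}:A^k\to A^{d-k}$ is an isomorphism; the form $(-1)^k\deg(\ell^{d-2k}\eta_1\eta_2)$ is positive definite on $\ker(\ell^{d-2k+1})\subseteq A^k$; and $\mathrm{st}_\Sigma(\sigma)$ is Lefschetz of dimension $d-k$ for every $k$-dimensional cone $\sigma$, $k>0$. Mixed HL: for $0\le k\le d/2$ and all $\ell_1,\dots,\ell_{d-2k}\in\mathscr K(\Sigma)$, multiplication by $\prod_{i=1}^{d-2k}\ell_i:A^k(\Sigma)\to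 A^{d-k}(\Sigma)$ is an isomorphism. Mixed HR: for $0\le k\le d/2$ and all $\ell_0,\dots,\ell_{d-2k}\in\mathscr K(\Sigma)$, the form $(\eta_1,\eta_2)\mapsto(-1)^k\deg((\prod_{i=1}^{d-2k}\ell_i)\eta_1\eta_2)$ is positive definite on the kernel of multiplication by $\prod_{i=0}^{d-2k}\ell_i$ on $A^k(\Sigma)$. *)

(* Defs.v *)
From HB Require Import structures.
From mathcomp Require Import all_boot all_order all_algebra.
From mathcomp Require Import boolp classical_sets functions reals.
From mathcomp Require Import mpoly.

Set Implicit Arguments.
Unset Strict Implicit.
Unset Printing Implicit Defensive.

Import Order.TTheory GRing.Theory Num.Theory.

Local Open Scope classical_set_scope.
Local Open Scope ring_scope.
Local Open Scope quotient_scope.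

(* The lattice is 'rV[int]_n, the ambient space is 'rV[R]_n.  A cone is       *)
(* encoded by the set of (indices of) its rays.  An index i such that [set i] *)
(* is not a cone is not a ray of the fan, and [ray i] is then irrelevant:     *)
(* this allows a fan and its stars to share the same index type.              *)
Record fan (I : finType) (n : nat) := Fan {
  ray : I -> 'rV[int]_n;
  cones : {set {set I}} }.

(* The nonnegative generator of the ideal spanned by the coordinates of v. *)
Definition content n (v : 'rV[int]_n) : nat :=
  \big[gcdn/0%N]_(j < n) absz (v 0 j).

Definition primitive_part n (v : 'rV[int]_n) : 'rV[int]_n :=
  \row_j (v ord0 j %/ (content v)%:Z)%Z.

Definition dim (I : finType) n (S : fan I n) : nat :=
  \max_(s in cones S) #|s|.

(* The image of S in Z^m, along q : Z^n -> Z^m with kernel spanned by s. *)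
Definition star (I : finType) n (S : fan I n) (s : {set I}) m
    (q : 'M[int]_(n, m)) : fan I m :=
  Fan (fun i => primitive_part (ray S i *m q))
      [set t :\: s | t in cones S & s \subset t]%SET.

(* The subfan of S made of the cones containing s and of their faces. *)
Definition closed_star (I : finType) n (S : fan I n) (s : {set I}) : fan I n :=
  Fan (ray S) [set t in cones S | t :|: s \in cones S]%SET.

Section Cones.
Variables (R : realType) (I : finType) (n : nat) (S : fan I n).

Definition rayR (i : I) : 'rV[R]_n := map_mx intr (ray S i).

Definition cone (s : {set I}) : set 'rV[R]_n :=
  [set x | exists2 c : I -> R,
     (forall i, 0 <= c i) & x = \sum_(i in s) c i *: rayR i].

Definition cone_span (s : {set I}) : 'M[R]_n := (\sum_(i in s) <<rayR i>>)%MS.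

Definition supp : set 'rV[R]_n := [set x | exists2 s, s \in cones S & cone s x].

Definition simplicial_fan : Prop :=
  [/\ finset.set0 \in cones S,
      (forall s t : {set I}, s \in cones S -> t \subset s -> t \in cones S),
      (forall i, [set i]%SET \in cones S -> content (ray S i) = 1%N),
      (forall s : {set I}, s \in cones S -> \rank (cone_span s) = #|s|) &
      (forall s t : {set I}, s \in cones S -> t \in cones S ->
         cone s `&` cone t = cone (s :&: t)%SET)].

(* q : Z^n -> Z^m identifies Z^m with N_Z / (N_Z :&: span s), and therefore   *)
(* R^m with N / span s.                                                       *)
Definition quotient_by (s : {set I}) m (q : 'M[int]_(n, m)) : Prop :=
  (forall w : 'rV[int]_m, exists v, v *m q = w) /\
  (forall v : 'rV[int]_n, v *m q = 0 <-> (map_mx intr v <= cone_span s)%MS).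

(* The index of the lattice generated by the rays of s in N_Z :&: span s is   *)
(* m: e lists representatives of the cosets.                                  *)
Definition multiplicity (s : {set I}) (m : nat) : Prop :=
  exists2 e : 'I_m -> 'rV[int]_n,
    (forall j, map_mx intr (e j) <= cone_span s)%MS &
    forall v : 'rV[int]_n, (map_mx intr v <= cone_span s)%MS ->
      exists! j, exists c : I -> int, v - e j = \sum_(i in s) c i *: ray S i.

End Cones.

Arguments rayR R {I n} S i.
Arguments supp R {I n} S.
Arguments cone_span R {I n} S s.
Arguments simplicial_fan R {I n} S.
Arguments quotient_by R {I n} S s {m} q.
Arguments multiplicity R {I n} S s m.

Section ChowRing.
Variables (R : realType) (I : finType) (n : nat) (S : fan I n).

Local Notation X := (supp R S).

Definition peval (p : mpoly n R) (x : 'rV[R]_n) : R :=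
  meval (fun j => x 0 j) p.

Definition pp_pred : {pred (X -> R)} := fun f => `[< forall s, s \in cones S ->
  exists p, forall x : X, cone S s (val x) -> f x = peval p (val x) >].

Fact pp_subring : subring_closed pp_pred.
Proof.
split=> [|f g /asboolP fP /asboolP gP|f g /asboolP fP /asboolP gP];
  apply/asboolP => s sS.
- by exists 1 => x _; rewrite /peval meval1.
- have [p pP] := fP s sS; have [r rP] := gP s sS; exists (p - r) => x xs.
  by rewrite /peval mevalB -!/(peval _ _) -pP // -rP.
- have [p pP] := fP s sS; have [r rP] := gP s sS; exists (p * r) => x xs.
  by rewrite /peval mevalM -!/(peval _ _) -pP // -rP.
Qed.

HB.instance Definition _ :=
  GRing.isSubringClosed.Build (X -> R) pp_pred pp_subring.

Record PP := MkPP { pp_fun :> X -> R; _ : pp_fun \in pp_pred }.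

HB.instance Definition _ := [isSub of PP for pp_fun].
HB.instance Definition _ := [Choice of PP by <:].
HB.instance Definition _ := GRing.SubChoice_isSubComPzRing.Build (X -> R) pp_pred PP pp_subring.



Fact lin_pp (l : 'cV[R]_n) : (fun x : X => (val x *m l) 0 0) \in pp_pred.
Proof.
apply/asboolP => s _; exists (\sum_j (l j 0 *: 'X_j)) => x _.
rewrite /peval raddf_sum mxE; apply: eq_bigr => j _ /=.
by rewrite mevalZ mevalXU mulrC.
Qed.

Definition lin (l : 'cV[R]_n) : PP := MkPP (lin_pp l).

Fact const_pp (c : R) : cst c \in pp_pred.
Proof. by apply/asboolP => s _; exists c%:MP => x _; rewrite /peval mevalC. Qed.

Definition const (c : R) : PP := MkPP (const_pp c).

(* The ideal of PP generated by the global linear functions. *)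
Definition lin_ideal : {pred PP} := fun f =>
  `[< exists e : seq ('cV[R]_n * PP), f = \sum_(p <- e) lin p.1 * p.2 >].

Fact lin_ideal_zmod : zmod_closed lin_ideal.
Proof.
split=> [|f g /asboolP[e ->] /asboolP[e' ->]]; apply/asboolP.
  by exists [::]; rewrite big_nil.
exists (e ++ [seq (p.1, - p.2) | p <- e']).
rewrite big_cat big_map -sumrN; congr (_ + _).
by apply: eq_bigr => p _; rewrite mulrN.
Qed.

HB.instance Definition _ :=
  GRing.isZmodClosed.Build PP lin_ideal lin_ideal_zmod.

Fact lin_idealM f g : g \in lin_ideal -> f * g \in lin_ideal.
Proof.
move=> /asboolP[e ->]; apply/asboolP.
exists [seq (p.1, f * p.2) | p <- e].
by rewrite big_map mulr_sumr; apply: eq_bigr => p _; rewrite mulrCA.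
Qed.

(* The library's quotient rings only cover proper ideals of nonzero rings,    *)
(* hence the ring structure below on the library's quotient group.            *)
Definition chow : Type := {ideal_quot lin_ideal}.

HB.instance Definition _ := GRing.Zmodule.on chow.
HB.instance Definition _ := EqQuotient.on chow.

Definition class (f : PP) : chow := \pi_chow f.

Fact classE f g : class f = class g <-> f - g \in lin_ideal.
Proof. by rewrite Quotient.idealrBE; split => [fg|/eqP//]; apply/eqP. Qed.

Fact classB : {morph class : f g / f - g}.
Proof. by move=> f g; rewrite /class pi_addr pi_oppr. Qed.

Fact classD : {morph class : f g / f + g}.
Proof. by move=> f g; rewrite /class pi_addr. Qed.

Fact class_repr (a : chow) : class (repr a) = a.
Proof. exact: reprK. Qed.

Definition chow_mul (a b : chow) : chow := class (repr a * repr b).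

Fact class_mul f g : chow_mul (class f) (class g) = class (f * g).
Proof.
apply/classE; set f' := repr _; set g' := repr _.
have ff' : f' - f \in lin_ideal by apply/classE; rewrite class_repr.
have gg' : g' - g \in lin_ideal by apply/classE; rewrite class_repr.
rewrite -(subrK (f' * g) (f' * g')) -mulrBr -addrA -mulrBl.
by rewrite rpredD ?(mulrC _ g); [| exact: lin_idealM..].
Qed.

Fact chow_mulA : associative chow_mul.
Proof.
move=> a b c; rewrite -[a]class_repr -[b]class_repr -[c]class_repr.
by rewrite !class_mul mulrA.
Qed.

Fact chow_mulC : commutative chow_mul.
Proof. by move=> a b; rewrite /chow_mul mulrC. Qed.

Fact chow_mul1 : left_id (class 1) chow_mul.
Proof. by move=> a; rewrite -[a]class_repr class_mul mul1r. Qed.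

Fact chow_mulD : left_distributive chow_mul +%R.
Proof.
move=> a b c; rewrite -[a]class_repr -[b]class_repr -[c]class_repr.
by rewrite -classD !class_mul -classD mulrDl.
Qed.

HB.instance Definition _ := GRing.Zmodule_isComPzRing.Build chow
  chow_mulA chow_mulC chow_mul1 chow_mulD.

Definition chow_scale (c : R) (a : chow) : chow := class (const c) * a.

Fact chow_scaleA c c' a : chow_scale c (chow_scale c' a) = chow_scale (c * c') a.
Proof.
by rewrite /chow_scale mulrA [_ * class _]class_mul; congr (class _ * _); exact/val_inj.
Qed.

Fact chow_scale1 : left_id 1 chow_scale.
Proof.
move=> a; rewrite /chow_scale (_ : const 1 = 1) ?mul1r //; exact/val_inj.
Qed.

Fact chow_scaleDr : right_distributive chow_scale +%R.
Proof. by move=> c a b; rewrite /chow_scale mulrDr. Qed.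

Fact chow_scaleDl a : {morph chow_scale^~ a : c c' / c + c'}.
Proof.
move=> c c'; rewrite /chow_scale -mulrDl -classD; congr (class _ * _).
exact/val_inj.
Qed.

HB.instance Definition _ := GRing.Zmodule_isLmodule.Build R chow
  chow_scaleA chow_scale1 chow_scaleDr chow_scaleDl.

(* k = 1: the piecewise linear functions *)
Definition pp_homog (k : nat) (f : PP) : Prop := forall s, s \in cones S ->
  exists2 p : {mpoly R[n]}, p \is k.-homog &
    forall x : X, cone S s (val x) -> f x = peval p (val x).

Definition chow_deg (k : nat) : set chow := class @` pp_homog k.

(* The piecewise linear function that is 1 on the primitive generator of the  *)
(* ray i and vanishes on the other rays.                                      *)
Definition courant (i : I) (f : PP) : Prop :=
  pp_homog 1 f /\ forall j, [set j]%SET \in cones S ->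
    forall x : X, val x = rayR R S j -> f x = (i == j)%:R.

(* In the quotient by span t, the primitive generator of the image of a cone  *)
(* i |: t is the generator of the corresponding ray of the star of t.         *)
Definition minkowski_weight (k : nat) (w : {set I} -> R) : Prop :=
  forall t, t \in cones S -> #|t|.+1 = k ->
  forall m (q : 'M[int]_(n, m)), quotient_by R S t q ->
  \sum_(i | (i \notin t) && (i |: t \in cones S)%SET)
     w (i |: t)%SET *: rayR R (star S t q) i = 0.

Definition fundamental_weight (d : nat) (w : {set I} -> R) : Prop :=
  [/\ minkowski_weight d w,
      (forall s : {set I}, s \in cones S -> #|s| = d -> 0 < w s) &
      (forall w', minkowski_weight d w' -> exists c, forall s : {set I},
         s \in cones S -> #|s| = d -> w' s = c * w s)].

(* The linear functional eta |-> (eta cap w) on A^d: it maps the product of   *)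
(* the Courant functions of the rays of a d-dimensional cone s to             *)
(* w s / mult s.                                                              *)
Definition degree_map (d : nat) (w : {set I} -> R) (deg : {scalar chow}) : Prop :=
  forall (s : {set I}) (m : nat) (x : I -> PP),
    s \in cones S -> #|s| = d -> multiplicity R S s m ->
    (forall i, i \in s -> courant i (x i)) ->
    m%:R * deg (\prod_(i in s) class (x i)) = w s.

End ChowRing.

Arguments chow R {I n} S.
Arguments chow_deg R {I n} S k.
Arguments minkowski_weight R {I n} S k w.
Arguments fundamental_weight {R I n} S d w.

Section Lefschetz.
Variables (R : realType) (I : finType).

Section Restriction.
Variables (n : nat) (S : fan I n).

(* a is mapped to b by the restriction A(S) -> A(star S s q).  The pullback   *)
(* along q identifies A(star S s q) with A(closed_star S s), because any      *)
(* linear function on span s extends to a global linear function; a and b     *)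
(* correspond to each other when they have the same image in the latter ring, *)
(* namely h and h'.                                                           *)
Definition restriction (s : {set I}) m (q : 'M[int]_(n, m))
    (a : chow R S) (b : chow R (star S s q)) : Prop :=
  exists (f : PP R S) (g : PP R (star S s q)) (h h' : PP R (closed_star S s)),
    [/\ class f = a, class g = b,
        (forall x y, val x = val y -> h x = f y),
        (forall x y, val x *m map_mx intr q = val y -> h' x = g y) &
        class h = class h'].

(* The set denoted by a script K in the literature. *)
Definition ample (l : chow R S) : Prop :=
  chow_deg R S 1 l /\
  forall s, s \in cones S ->
  forall m (q : 'M[int]_(n, m)), quotient_by R S s q ->
  exists2 g : PP R (star S s q),
    restriction l (class g) &
    pp_homog 1 g /\ forall x : supp R (star S s q), val x != 0 -> 0 < g x.

Definition poincare_duality (d : nat) (deg : {scalar chow R S}) : Prop :=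
  forall k, (k <= d)%N ->
  (forall a, chow_deg R S k a ->
     (forall b, chow_deg R S (d - k) b -> deg (a * b) = 0) -> a = 0) /\
  (forall b, chow_deg R S (d - k) b ->
     (forall a, chow_deg R S k a -> deg (a * b) = 0) -> b = 0).

Definition hard_lefschetz (d : nat) : Prop :=
  forall k, (k.*2 <= d)%N -> forall l, ample l ->
  set_bij (chow_deg R S k) (chow_deg R S (d - k))
    (fun a => l ^+ (d - k.*2) * a).

Definition hodge_riemann (d : nat) (deg : {scalar chow R S}) : Prop :=
  forall k, (k.*2 <= d)%N -> forall l, ample l ->
  forall a, chow_deg R S k a -> l ^+ (d - k.*2).+1 * a = 0 -> a != 0 ->
  0 < (-1) ^+ k * deg (l ^+ (d - k.*2) * a * a).

Definition mixed_hard_lefschetz (d : nat) : Prop :=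
  forall k, (k.*2 <= d)%N -> forall l : nat -> chow R S,
  (forall i, (1 <= i <= d - k.*2)%N -> ample (l i)) ->
  set_bij (chow_deg R S k) (chow_deg R S (d - k))
    (fun a => (\prod_(1 <= i < (d - k.*2).+1) l i) * a).

Definition mixed_hodge_riemann (d : nat) (deg : {scalar chow R S}) : Prop :=
  forall k, (k.*2 <= d)%N -> forall l : nat -> chow R S,
  (forall i, (i <= d - k.*2)%N -> ample (l i)) ->
  forall a, chow_deg R S k a ->
  (\prod_(0 <= i < (d - k.*2).+1) l i) * a = 0 -> a != 0 ->
  0 < (-1) ^+ k * deg ((\prod_(1 <= i < (d - k.*2).+1) l i) * a * a).

End Restriction.

Inductive lefschetz : forall n, fan I n -> nat -> Prop :=
| Lefschetz n (S : fan I n) (d : nat) (w : {set I} -> R)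
    (deg : {scalar chow R S}) of
    dim S = d &
    fundamental_weight S d w &
    degree_map d w deg &
    set_bij (chow_deg R S d) [set: R] deg &
    poincare_duality d deg &
    hard_lefschetz S d &
    hodge_riemann d deg &
    (forall s : {set I}, s \in cones S -> (0 < #|s|)%N ->
       forall m (q : 'M[int]_(n, m)), quotient_by R S s q ->
       lefschetz (star S s q) (d - #|s|)) :
    lefschetz S d.

End Lefschetz.

Arguments lefschetz R {I n} S d.
Arguments mixed_hard_lefschetz R {I n} S d.

(* Main.v *)
(* By induction on the dimension, the stars of the rays satisfy mixed HR.  If
   [L a = 0] with [L = l_1 ... l_m], write [l_1] as a positive combination of the
   classes [x_i] of the rays.  The restriction of [a] to the star of each ray is
   primitive there, so [0 = deg (L a a)] is, up to sign, a sum of nonnegative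
   terms; hence all these restrictions vanish, so [x_i a = 0] for all [i], and
   [a = 0] by Poincare duality.  This is mixed HL.

   For mixed HR, keep [l_0] and move the other classes along segments, which stay
   in the ample cone, from [l_0] to [l_i].  Mixed HL in degrees [k] and [k - 1]
   says that the form stays nondegenerate on [A^k] and on [l_0 A^(k-1)], whose
   orthogonal complement is the primitive part; so positivity on the primitive
   part, which holds at the start by HR, persists. *)

Require Import Defs.
From mathcomp Require Import all_boot all_order all_algebra.
From mathcomp Require Import boolp classical_sets functions reals.
From mathcomp Require Import mpoly cauchyreals ring lra zify.

Set Implicit Arguments.
Unset Strict Implicit.
Unset Printing Implicit Defensive.

Import Order.TTheory GRing.Theory Num.Theory.

Local Open Scope classical_set_scope.
Local Open Scope ring_scope.

(** * Paths of symmetric forms *)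

Section PositiveDefinite.
Variable R : realType.

Definition form_at N (M : 'M[R]_N) (x y : 'rV[R]_N) : R := (x *m M *m y^T) 0 0.

Definition posdef N (M : 'M[R]_N) : Prop :=
  forall x, x != 0 -> 0 < form_at M x x.

Lemma form_atC N (M : 'M[R]_N) x y : M^T = M -> form_at M x y = form_at M y x.
Proof.
move=> Msym; rewrite /form_at.
transitivity ((x *m M *m y^T)^T 0 0); first by rewrite [RHS]mxE.
by rewrite !trmx_mul trmxK Msym mulmxA.
Qed.

Lemma row_sqr_gt0 N (v : 'rV[R]_N) : v != 0 -> 0 < (v *m v^T) 0 0.
Proof.
move=> v0; have sq j : true -> 0 <= v 0 j * v^T j 0 by move=> _; rewrite mxE -expr2 sqr_ge0.
rewrite lt_neqAle mxE sumr_ge0 // andbT eq_sym.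
apply: contraNneq v0 => /(psumr_eq0P sq) E; apply/eqP/rowP => j.
by apply/eqP; have /eqP := E j isT; rewrite !mxE mulf_eq0 orbb.
Qed.

Lemma kermx0_unitmx N (M : 'M[R]_N) :
  (forall x : 'rV_N, x *m M = 0 -> x = 0) -> M \in unitmx.
Proof.
move=> inj; rewrite -row_free_unit -kermx_eq0; apply/rowV0P => v.
by move/sub_kermxP; apply: inj.
Qed.

(* Completing the square:
   [a q(y, z) = (a y + b z)^2 + z (a C - b^T b) z^T]. *)
Lemma posdef_schur N (M : 'M[R]_(1 + N)) : M^T = M ->
  posdef M <-> 0 < ulsubmx M 0 0 /\
    posdef (ulsubmx M 0 0 *: drsubmx M - (ursubmx M)^T *m ursubmx M).
Proof.
move=> Msym; set a := ulsubmx M 0 0; set B := ursubmx M; set C := drsubmx M.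
have BT : dlsubmx M = B^T by rewrite /B -[in RHS]Msym trmx_ursub trmxK.
pose b (z : 'rV_N) := (B *m z^T) 0 0; pose c z := form_at C z z.
have qE (y : 'rV_1) z : form_at M (row_mx y z) (row_mx y z) =
    a * y 0 0 ^+ 2 + 2 * (y 0 0 * b z) + c z.
  rewrite /form_at -{1}[M]submxK tr_row_mx mul_row_block mul_row_col.
  rewrite !mulmxDl BT.
  have -> : z *m B^T *m y^T = (y *m B *m z^T)^T by rewrite !trmx_mul trmxK mulmxA.
  have E1 : (y *m ulsubmx M *m y^T) 0 0 = a * y 0 0 ^+ 2.
    by rewrite !mxE big_ord1 mxE big_ord1 mxE /a expr2 !mxE; ring.
  have E2 : (y *m B *m z^T) 0 0 = y 0 0 * b z.
    by rewrite -mulmxA mxE big_ord1.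
  rewrite mxE [X in X + _]mxE [X in _ + X]mxE [_^T 0 0]mxE E1 -/B E2 -/C /c /form_at.
  by ring.
have sE z : form_at (a *: C - B^T *m B) z z = a * c z - b z ^+ 2.
  rewrite /form_at mulmxBr mulmxBl -scalemxAr -scalemxAl mxE [X in X + _]mxE -/(form_at C z z).
  rewrite -/(c z); congr (_ + _); rewrite [LHS]mxE mulmxA.
  have -> : z *m B^T = (B *m z^T)^T by rewrite trmx_mul trmxK.
  by congr (- _); rewrite -mulmxA mxE big_ord1 mxE expr2.
have b0 : b 0 = 0 by rewrite /b trmx0 mulmx0 mxE.
have c0 : c 0 = 0 by rewrite /c /form_at trmx0 mulmx0 mxE.
split=> [Mpos|[a0 Cpos] x x0].
  have a0 : 0 < a.
    have := Mpos (row_mx 1%:M 0); rewrite qE b0 c0 !mxE /= expr1n mulr1 !mulr0 !addr0; apply.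
    by rewrite row_mx_eq0 negb_and -[1%:M]/(1 : 'M[R]_1) oner_neq0.
  split=> // z z0; rewrite sE.
  have := Mpos (row_mx (- (b z / a))%:M z).
  rewrite row_mx_eq0 negb_and z0 orbT => /(_ isT).
  rewrite qE mxE eqxx mulr1n => /(mulr_gt0 a0); congr (_ < _).
  by field; rewrite gt_eqF.
move: x0; rewrite -[x]hsubmxK row_mx_eq0 negb_and qE.
set y := lsubmx x; set z := rsubmx x.
have [->|z0] := eqVneq z 0.
  rewrite orbF b0 c0 !mulr0 !addr0 => y0; rewrite mulr_gt0 // exprn_even_gt0 //=.
  by apply: contraNneq y0 => y0; apply/eqP/rowP => j; rewrite ord1 y0 mxE.
move=> _; have := Cpos z z0; rewrite sE => s0; rewrite -(pmulr_rgt0 _ a0).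
suff -> : a * (a * y 0 0 ^+ 2 + 2 * (y 0 0 * b z) + c z) =
  (a * y 0 0 + b z) ^+ 2 + (a * c z - b z ^+ 2) by rewrite ltr_wpDl ?sqr_ge0.
by ring.
Qed.

Lemma semidef_unit_posdef N (M : 'M[R]_N) : M^T = M -> M \in unitmx ->
  (forall x, 0 <= form_at M x x) -> posdef M.
Proof.
move=> Msym Munit Mpos x x0; rewrite lt_neqAle Mpos andbT eq_sym.
apply: contraNneq x0 => xx; suff xM : x *m M = 0.
  by apply/eqP; rewrite -(mulmxK Munit x) xM mul0mx.
apply/rowP => j; rewrite [RHS]mxE; pose y : 'rV[R]_N := delta_mx 0 j.
have -> : (x *m M) 0 j = form_at M x y.
  by rewrite /form_at /y trmx_delta -colE [RHS]mxE.
set b := form_at M x y; pose c := form_at M y y.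
have qE s : form_at M (x + s *: y) (x + s *: y) = 2 * s * b + s ^+ 2 * c.
  have lin u v w : form_at M (u + s *: v) w = form_at M u w + s * form_at M v w.
    by rewrite /form_at !mulmxDl -!scalemxAl !mxE.
  rewrite lin !(form_atC _ (x + _) Msym) !lin xx -/c (form_atC y x Msym) -/b; ring.
have c0 : 0 <= c := Mpos y.
have := Mpos (x + (- (b / (c + 1))) *: y); rewrite qE => le0.
have c1 : c + 1 != 0 by rewrite gt_eqF // ltr_wpDl.
have := mulr_ge0 le0 (sqr_ge0 (c + 1)).
have -> : (2 * - (b / (c + 1)) * b + (- (b / (c + 1))) ^+ 2 * c) * (c + 1) ^+ 2
   = - (b ^+ 2 * (c + 2)) by field.
rewrite oppr_ge0 pmulr_lle0; last by rewrite ltr_wpDl.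
by move=> b2; apply/eqP; rewrite -sqrf_eq0 eq_le b2 sqr_ge0.
Qed.

Lemma horner_gt0_near (p : {poly R}) t : 0 < p.[t] ->
  exists2 e, 0 < e & forall s, `|s - t| <= e -> 0 < p.[s].
Proof.
move=> pt; have K0 : 0 < poly_accr_bound p t 1 by exact: poly_accr_bound_gt0.
exists (Num.min 1 (p.[t] / poly_accr_bound p t 1 / 2)).
  by rewrite lt_min ltr01 !divr_gt0.
move=> s; rewrite le_min => /andP[s1 s2].
have := @poly_accr_bound1P _ p t 1 t s; rewrite subrr normr0 ler01 => /(_ isT s1).
set K := poly_accr_bound p t 1 in K0 s2 *.
have : `|s - t| * K <= p.[t] / 2.
  by rewrite -(ler_pdivlMr _ _ K0) (le_trans s2) // mulrAC.
rewrite ler_norml => ? /andP[? _]; lra.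
Qed.

Definition eval_mx m n (t : R) (F : 'M[{poly R}]_(m, n)) : 'M[R]_(m, n) :=
  map_mx (horner_eval t) F.

Lemma posdef_near N (F : 'M[{poly R}]_N) t : F^T = F -> posdef (eval_mx t F) ->
  exists2 e, 0 < e & forall s, `|s - t| <= e -> posdef (eval_mx s F).
Proof.
elim: N F => [|N IH] F Fsym; first by exists 1 => // s _ x; rewrite [x]thinmx0 eqxx.
have evsym s : (eval_mx s F)^T = eval_mx s F by rewrite /eval_mx map_trmx Fsym.
pose H : 'M_N := @ulsubmx _ 1 N 1 N F 0 0 *: @drsubmx _ 1 N 1 N F
   - (@ursubmx _ 1 N 1 N F)^T *m @ursubmx _ 1 N 1 N F.
have Hsym : H^T = H.
  rewrite /H linearB linearZ /= trmx_mul trmxK.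
  by congr (_ *: _ - _); rewrite trmx_drsub Fsym.
have HE s : eval_mx s H = @ulsubmx _ 1 N 1 N (eval_mx s F) 0 0 *: @drsubmx _ 1 N 1 N (eval_mx s F)
   - (@ursubmx _ 1 N 1 N (eval_mx s F))^T *m @ursubmx _ 1 N 1 N (eval_mx s F).
  rewrite /eval_mx /H map_mxB map_mxZ map_mxM -map_trmx.
  by rewrite map_ursubmx map_drsubmx /ulsubmx !mxE.
have aE s : @ulsubmx _ 1 N 1 N (eval_mx s F) 0 0 = (@ulsubmx _ 1 N 1 N F 0 0).[s].
  by rewrite /eval_mx -map_ulsubmx [LHS]mxE.
move/(@posdef_schur N _ (evsym t)) => [a0]; rewrite -HE => /(IH _ Hsym)[e1 e10 He1].
rewrite aE in a0; have [e2 e20 He2] := horner_gt0_near a0.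
exists (Num.min e1 e2) => [|s]; first by rewrite lt_min e10.
rewrite le_min => /andP[s1 s2]; apply/(@posdef_schur N _ (evsym s)).
by rewrite -HE aE; split; [exact: He2 | exact: He1].
Qed.

Lemma posdef_path N (F : 'M[{poly R}]_N) : F^T = F ->
  (forall t, 0 <= t <= 1 -> eval_mx t F \in unitmx) ->
  posdef (eval_mx 0 F) -> posdef (eval_mx 1 F).
Proof.
move=> Fsym Funit F0.
have evsym s : (eval_mx s F)^T = eval_mx s F by rewrite /eval_mx map_trmx Fsym.
pose S := [set t : R | 0 <= t <= 1 /\ forall s, 0 <= s <= t -> posdef (eval_mx s F)].
have S0 : S 0.
  split=> [|s]; first by rewrite lexx ler01.
  by move=> s0; have -> : s = 0 by apply/eqP; rewrite eq_le andbC.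
have Sub : has_ubound S by exists 1 => t [/andP[]].
have Ssup : has_sup S by split=> //; exists 0.
set T := sup S.
have T0 : 0 <= T by apply: ub_le_sup.
have T1 : T <= 1 by apply: ge_sup; [exists 0 | move=> t [/andP[]]].
have lt s : 0 <= s -> s < T -> posdef (eval_mx s F).
  move=> s0 sT; have [t [t1 tP] st] := sup_gt (ex_intro _ 0 S0) sT.
  by apply: tP; rewrite s0 ltW.
have PT : posdef (eval_mx T F).
  have [<-//|Tn0] := eqVneq 0 T.
  apply: semidef_unit_posdef => //; first by apply: Funit; rewrite T0.
  move=> x; pose p : {poly R} := (map_mx polyC x *m F *m map_mx polyC x^T) 0 0.
  have pE s : form_at (eval_mx s F) x x = p.[s].
    rewrite /form_at -[RHS]/(horner_eval s p) /p.
    transitivity (map_mx (horner_eval s) (map_mx polyC x *m F *m map_mx polyC x^T) 0 0).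
      rewrite !map_mxM -!map_mx_comp.
      by congr (_ 0 0); congr (_ *m _ *m _); apply/matrixP => i j; rewrite !mxE /= /horner_eval hornerC.
    by rewrite mxE.
  rewrite pE leNgt; apply/negP => pT.
  have [e e0 He] := @horner_gt0_near (- p) T (ltac:(by rewrite hornerN oppr_gt0)).
  have {}Tn0 : 0 < T by rewrite lt_neqAle Tn0.
  pose s := T - Num.min e T; have m0 : 0 < Num.min e T by rewrite lt_min e0.
  have s0 : 0 <= s by rewrite subr_ge0 ge_min lexx orbT.
  have sT : s < T by rewrite ltrBlDr ltrDl.
  have := He s; rewrite addrAC subrr add0r normrN gtr0_norm // ge_min lexx => /(_ isT).
  rewrite hornerN oppr_gt0 -pE => neg; have [x0|x0] := eqVneq x 0.
    by move: neg; rewrite x0 /form_at trmx0 mulmx0 mxE ltxx.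
  by have := lt s s0 sT x x0; rewrite ltNge ltW.
have [<-//|Tn1] := eqVneq T 1.
have {}Tn1 : T < 1 by rewrite lt_neqAle Tn1.
have [e e0 He] := posdef_near Fsym PT.
pose t := T + Num.min e (1 - T).
have m0 : 0 < Num.min e (1 - T) by rewrite lt_min e0 subr_gt0.
suff St : S t by have := ub_le_sup Sub St; rewrite leNgt ltrDl m0.
split=> [|s /andP[s0 st]].
  by rewrite addr_ge0 ?(ltW m0) //= /t -lerBrDl ge_min lexx orbT.
have [|Ts] := ltP s T; first exact: lt.
apply: He; rewrite ger0_norm ?subr_ge0 // lerBlDl (le_trans st) // lerD2l.
by rewrite ge_min lexx.
Qed.

(* [split_form] trades the varying subspace [{x | x G W^T = 0}] for a form on *)
(* the whole space, polynomial in the entries of [G]; [split_proj] is, up to  *)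
(* the factor [\det (W G W^T)], the [G]-orthogonal projection along the row   *)
(* space of [W].                                                              *)
Definition split_proj (K : comNzRingType) r N (G : 'M[K]_N) (W : 'M[K]_(r, N)) : 'M[K]_N :=
  (\det (W *m G *m W^T))%:M - G *m W^T *m \adj (W *m G *m W^T) *m W.

Definition split_form (K : comNzRingType) r N (G : 'M[K]_N) (W : 'M[K]_(r, N)) : 'M[K]_N :=
  split_proj G W *m G *m (split_proj G W)^T + G *m W^T *m (G *m W^T)^T.

Definition posdef_orth r N (G : 'M[R]_N) (W : 'M[R]_(r, N)) : Prop :=
  forall x : 'rV_N, x *m G *m W^T = 0 -> x != 0 -> 0 < form_at G x x.

Section Split.
Variables (r N : nat) (G : 'M[R]_N) (W : 'M[R]_(r, N)).
Hypotheses (Gunit : G \in unitmx) (Wunit : W *m G *m W^T \in unitmx).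
Let D := \det (W *m G *m W^T).
Let P := split_proj G W.

Let D0 : D != 0. Proof. by move: Wunit; rewrite unitmxE unitfE. Qed.

Lemma split_proj_orth : P *m G *m W^T = 0.
Proof.
rewrite /P /split_proj !mulmxBl mul_scalar_mx -scalemxAl.
rewrite -!mulmxA (mulmxA W G) mul_adj_mx mul_mx_scalar -/D.
by rewrite -scalemxAr subrr.
Qed.

Lemma split_proj_id (x : 'rV_N) : x *m G *m W^T = 0 -> x *m P = D *: x.
Proof.
by move=> x0; rewrite /P /split_proj mulmxBr mul_mx_scalar !mulmxA x0 !mul0mx subr0.
Qed.

Lemma split_formE (x y : 'rV_N) : form_at (split_form G W) x y =
  form_at G (x *m P) (y *m P) + ((x *m G *m W^T) *m (y *m G *m W^T)^T) 0 0.
Proof.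
rewrite /form_at /split_form -/P mulmxDr mulmxDl mxE.
by rewrite !trmx_mul !trmxK !mulmxA.
Qed.

Lemma posdef_split : posdef (split_form G W) <-> posdef_orth G W.
Proof.
split=> [pos x xW x0|pos x x0].
  have := pos x x0; rewrite split_formE xW mul0mx [X in _ + X]mxE addr0.
  rewrite (split_proj_id xW) /form_at linearZ /= -scalemxAr -!scalemxAl scalerA mxE.
  by rewrite pmulr_rgt0 // -expr2 exprn_even_gt0.
rewrite split_formE; have [xW|xW] := eqVneq (x *m G *m W^T) 0.
  rewrite xW mul0mx [X in _ + X]mxE addr0; apply: pos.
    by rewrite -!mulmxA (mulmxA P) split_proj_orth mulmx0.
  by rewrite (split_proj_id xW) scaler_eq0 negb_or D0.
rewrite ltr_wpDl ?row_sqr_gt0 //.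
have [->|u0] := eqVneq (x *m P) 0; first by rewrite /form_at !mul0mx mxE.
by rewrite ltW //; apply: pos => //; rewrite -!mulmxA (mulmxA P) split_proj_orth mulmx0.
Qed.

Lemma split_form_unit : split_form G W \in unitmx.
Proof.
apply: kermx0_unitmx => x xF.
have form0 y : form_at (split_form G W) x y = 0 by rewrite /form_at xF mul0mx mxE.
have PW (y : 'rV_N) : y *m P *m G *m W^T = 0.
  by rewrite -!mulmxA (mulmxA P) split_proj_orth mulmx0.
have uGP : x *m P *m G *m P^T = 0.
  apply/rowP => j; rewrite [RHS]mxE.
  have := form0 (delta_mx 0 j *m P); rewrite split_formE PW trmx0 mulmx0.
  rewrite [X in _ + X]mxE addr0 (split_proj_id (PW _)) /form_at linearZ /= -scalemxAr mxE.
  move/eqP; rewrite mulf_eq0 (negbTE D0) /= trmx_mul mulmxA trmx_delta -colE mxE.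
  by move/eqP.
have u0 : x *m P = 0.
  suff DuG : D *: (x *m P *m G) = 0.
    move/eqP: DuG; rewrite scaler_eq0 (negbTE D0) /= => /eqP uG.
    by rewrite -[LHS](mulmxK Gunit) uG mul0mx.
  have PT : P^T = D%:M - W^T *m (G *m W^T *m \adj (W *m G *m W^T))^T.
    by rewrite /P /split_proj [LHS]linearB /= tr_scalar_mx trmx_mul.
  by move: uGP; rewrite PT mulmxBr mul_mx_scalar mulmxA PW mul0mx subr0.
have := form0 x; rewrite split_formE u0 /form_at !mul0mx mxE add0r => v0.
have {}v0 : x *m G *m W^T = 0.
  by apply: contra_eq v0 => v0; rewrite gt_eqF // row_sqr_gt0.
have := split_proj_id v0; rewrite u0 => /esym/eqP.
by rewrite scaler_eq0 (negbTE D0) => /eqP.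
Qed.

End Split.

Lemma posdef_orth_path r N (G : 'M[{poly R}]_N) (W : 'M[R]_(r, N)) : G^T = G ->
  (forall t, 0 <= t <= 1 -> eval_mx t G \in unitmx) ->
  (forall t, 0 <= t <= 1 -> W *m eval_mx t G *m W^T \in unitmx) ->
  posdef_orth (eval_mx 0 G) W -> posdef_orth (eval_mx 1 G) W.
Proof.
move=> Gsym Gunit Wunit; pose W' : 'M[{poly R}]_(r, N) := map_mx polyC W.
have W'E t : eval_mx t W' = W.
  by apply/matrixP => i j; rewrite !mxE /= /horner_eval hornerC.
have evE t : eval_mx t (split_form G W') = split_form (eval_mx t G) W.
  pose f : {rmorphism {poly R} -> R} := horner_eval t.
  have projE : map_mx f (split_proj G W') = split_proj (map_mx f G) (map_mx f W').
    rewrite /split_proj map_mxB map_scalar_mx /= -(det_map_mx f).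
    by rewrite !map_mxM map_mx_adj !map_mxM -!map_trmx.
  rewrite -[in RHS](W'E t) /eval_mx -/f /split_form.
  by rewrite map_mxD !map_mxM -!map_trmx projE !map_mxM -!map_trmx.
have sym : (split_form G W')^T = split_form G W'.
  by rewrite /split_form linearD /= !trmx_mul !trmxK Gsym !mulmxA.
have P0 : 0 <= (0 : R) <= 1 by rewrite lexx ler01.
have P1 : 0 <= (1 : R) <= 1 by rewrite lexx ler01.
move=> /(posdef_split (Wunit 0 P0)); rewrite -evE => /(posdef_path sym) path.
apply/(posdef_split (Wunit 1 P1)); rewrite -evE; apply: path => t t01.
by rewrite evE; apply: split_form_unit; [exact: Gunit | exact: Wunit].
Qed.

End PositiveDefinite.

(** * Piecewise polynomials and Courant functions *)

Section PiecewisePolynomials.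
Variables (R : realType) (I : finType) (n : nat) (S : fan I n).
Implicit Types f g : PP R S.

Lemma PP_ext f g : (forall x, f x = g x) -> f = g.
Proof. by move=> fg; apply/val_inj/funext. Qed.

Lemma PP_addE f g x : (f + g) x = f x + g x. Proof. by []. Qed.
Lemma PP_oppE f x : (- f) x = - f x. Proof. by []. Qed.
Lemma PP_mulE f g x : (f * g) x = f x * g x. Proof. by []. Qed.

Lemma PP_sumE (J : Type) (r : seq J) (P : pred J) (F : J -> PP R S) x :
  (\sum_(j <- r | P j) F j) x = \sum_(j <- r | P j) F j x.
Proof. by elim/big_rec2: _ => // j y1 y2 _ <-. Qed.

Lemma chow_scaleE (c : R) (a : chow R S) : c *: a = class (const S c) * a.
Proof. by []. Qed.

Lemma chow_scaleAl (c : R) (a b : chow R S) : c *: a * b = c *: (a * b).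
Proof. by rewrite !chow_scaleE mulrA. Qed.

Lemma chow_scaleAr (c : R) (a b : chow R S) : a * (c *: b) = c *: (a * b).
Proof. by rewrite mulrC chow_scaleAl mulrC. Qed.

Lemma classM f g : class (f * g) = class f * class g.
Proof. by rewrite -class_mul. Qed.

Lemma class0 : class (0 : PP R S) = 0.
Proof. by rewrite -(subrr 0) classB subrr. Qed.

Lemma class_sum (J : Type) (r : seq J) (P : pred J) (F : J -> PP R S) :
  class (\sum_(j <- r | P j) F j) = \sum_(j <- r | P j) class (F j).
Proof. by apply: (big_morph (@class R I n S)); [exact: classD | exact: class0]. Qed.

Lemma class_eq0 f : class f = 0 <-> f \in lin_ideal (S:=S).
Proof. by rewrite -class0; rewrite classE subr0. Qed.

Lemma pp_homog0 k : pp_homog k (0 : PP R S).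
Proof. by move=> s _; exists 0; [exact: dhomog0 | move=> x _; rewrite /peval meval0]. Qed.

Lemma pp_homogD k f g : pp_homog k f -> pp_homog k g -> pp_homog k (f + g).
Proof.
move=> hf hg s sS; have [p ph pE] := hf s sS; have [q qh qE] := hg s sS.
by exists (p + q) => [|x xs]; rewrite ?dhomogD // PP_addE /peval mevalD (pE x xs) (qE x xs).
Qed.

Lemma pp_homogM k l f g : pp_homog k f -> pp_homog l g -> pp_homog (k + l) (f * g).
Proof.
move=> hf hg s sS; have [p ph pE] := hf s sS; have [q qh qE] := hg s sS.
by exists (p * q) => [|x xs]; rewrite ?dhomogM // PP_mulE /peval mevalM (pE x xs) (qE x xs).
Qed.

Lemma pp_homog_const (c : R) : pp_homog 0 (const S c).
Proof.
move=> s _; exists c%:MP => [|x _]; last by rewrite /peval mevalC.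
by rewrite -[c%:MP]mul1r mulrC mul_mpolyC dhomogZ // dhomog1.
Qed.

Lemma pp_homogZ k c f : pp_homog k f -> pp_homog k (const S c * f).
Proof. by move=> hf; rewrite -[k]add0n; apply: pp_homogM => //; exact: pp_homog_const. Qed.

Lemma pp_homogN k f : pp_homog k f -> pp_homog k (- f).
Proof.
move=> hf s sS; have [p ph pE] := hf s sS.
by exists (- p) => [|x xs]; rewrite ?dhomogN // PP_oppE /peval mevalN (pE x xs).
Qed.

Lemma pp_homog_sum k (J : Type) (r : seq J) (P : pred J) (F : J -> PP R S) :
  (forall j, P j -> pp_homog k (F j)) -> pp_homog k (\sum_(j <- r | P j) F j).
Proof. by move=> FP; elim/big_ind: _ => //; [exact: pp_homog0 | exact: pp_homogD]. Qed.

Lemma pp_homog_exists k (phi : supp R S -> R) :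
  (forall s, s \in cones S -> exists2 p : {mpoly R[n]}, p \is k.-homog &
    forall x : supp R S, cone S s (val x) -> phi x = peval p (val x)) ->
  exists2 f : PP R S, pp_homog k f & forall x, f x = phi x.
Proof.
move=> hphi; have phiP : phi \in pp_pred (S:=S).
  by apply/asboolP => s /hphi[p _ pE]; exists p.
by exists (MkPP phiP).
Qed.

Lemma chow_deg0 k : chow_deg R S k 0.
Proof. by exists 0; [exact: pp_homog0 | exact: class0]. Qed.

Lemma chow_degD k a b : chow_deg R S k a -> chow_deg R S k b -> chow_deg R S k (a + b).
Proof.
move=> [f hf <-] [g hg <-]; exists (f + g); first exact: pp_homogD.
exact: classD.
Qed.

Lemma chow_degM k l a b : chow_deg R S k a -> chow_deg R S l b ->
  chow_deg R S (k + l) (a * b).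
Proof.
move=> [f hf <-] [g hg <-]; exists (f * g); first exact: pp_homogM.
exact: classM.
Qed.

Lemma chow_degZ k c a : chow_deg R S k a -> chow_deg R S k (c *: a).
Proof.
move=> [f hf <-]; exists (const S c * f); first exact: pp_homogZ.
by rewrite classM.
Qed.

Lemma chow_degN k a : chow_deg R S k a -> chow_deg R S k (- a).
Proof. by rewrite -scaleN1r; exact: chow_degZ. Qed.

Lemma chow_degB k a b : chow_deg R S k a -> chow_deg R S k b -> chow_deg R S k (a - b).
Proof. by move=> ha hb; apply: chow_degD => //; exact: chow_degN. Qed.

Lemma chow_deg_sum k (J : Type) (r : seq J) (P : pred J) (F : J -> chow R S) :
  (forall j, P j -> chow_deg R S k (F j)) -> chow_deg R S k (\sum_(j <- r | P j) F j).
Proof. by move=> FP; elim/big_ind: _ => //; [exact: chow_deg0 | exact: chow_degD]. Qed.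

Lemma chow_deg1 : chow_deg R S 0 1.
Proof.
exists (const S (1 : R)); first exact: pp_homog_const.
by have -> : const S (1 : R) = 1 by apply: PP_ext.
Qed.

Lemma chow_deg_prod (J : Type) (r : seq J) (F : J -> chow R S) :
  (forall j, chow_deg R S 1 (F j)) -> chow_deg R S (size r) (\prod_(j <- r) F j).
Proof.
move=> FP; elim: r => [|j r IH]; first by rewrite big_nil; exact: chow_deg1.
by rewrite big_cons; exact: (@chow_degM 1).
Qed.

End PiecewisePolynomials.

Section LinearSubstitution.
Variables (R : realType).

Definition lin_mpoly n (l : 'cV[R]_n) : {mpoly R[n]} := \sum_j l j 0 *: 'X_j.

Lemma lin_mpoly_homog n (l : 'cV[R]_n) : lin_mpoly l \is 1.-homog.
Proof.
by apply: rpred_sum => j _; apply: rpredZ; rewrite dhomogX /= mdeg1.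
Qed.

Lemma peval_lin n (l : 'cV[R]_n) x : peval (lin_mpoly l) x = (x *m l) 0 0.
Proof.
rewrite /peval raddf_sum mxE; apply: eq_bigr => j _ /=.
by rewrite mevalZ mevalXU mulrC.
Qed.

Definition subst n m (M : 'M[R]_(n, m)) (p : {mpoly R[m]}) : {mpoly R[n]} :=
  p \mPo [tuple lin_mpoly (col j M) | j < m].

Lemma peval_subst n m (M : 'M[R]_(n, m)) p x : peval (subst M p) x = peval p (x *m M).
Proof.
rewrite /peval /subst comp_mpoly_meval; apply: meval_eq => j.
by rewrite tnth_mktuple -/(peval _ _) peval_lin !mxE; apply: eq_bigr => i _; rewrite mxE.
Qed.

Lemma subst_homog n m (M : 'M[R]_(n, m)) p k : p \is k.-homog -> subst M p \is k.-homog.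
Proof.
move=> /dhomogP hp; rewrite /subst comp_mpolyEX big_seq; apply: rpred_sum => e /hp /= <-.
apply: rpredZ; rewrite comp_mpolyX mdegE.
elim/big_rec2: _ => [|j y1 y2 _ h]; first exact: dhomog1.
apply: dhomogM => //; rewrite tnth_mktuple -[X in X.-homog]mul1n.
by apply: dhomogMn; exact: lin_mpoly_homog.
Qed.

Lemma homog_split n (p : {mpoly R[n]}) k : p \is k.+1.-homog ->
  exists2 q : 'I_n -> {mpoly R[n]}, forall j, q j \is k.-homog & p = \sum_j 'X_j * q j.
Proof.
move=> /dhomogP hp; rewrite (mpolyE p).
have : {subset msupp p <= msupp p} by [].
elim: {1 3}(msupp p) => [|e r IH] sub.
  exists (fun=> 0) => [j|]; first exact: dhomog0.
  by rewrite big_nil big1 // => j _; rewrite mulr0.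
have [|q qh qE] := IH; first by move=> e' e'r; apply: sub; rewrite inE e'r orbT.
have : mdeg e = k.+1 by apply: hp; apply: sub; rewrite inE eqxx.
rewrite big_cons qE => dege.
have [j ej] : exists j, (0 < e j)%N.
  apply/existsP; apply: contraT => /existsPn e0.
  by move: dege; rewrite mdegE big1 // => j _; apply/eqP; rewrite -leqn0 leqNgt.
have eE : e = (U_(j) + (e - U_(j)))%MM by rewrite addmC submK // lep1mP -lt0n.
exists (fun i => q i + (if i == j then p@_e *: 'X_[e - U_(j)] else 0)).
  move=> i; apply: rpredD => //; case: eqP => _; last exact: dhomog0.
  by apply: rpredZ; rewrite dhomogX /= -eqSS -dege {2}eE mdegD mdeg1 add1n.
under [RHS]eq_bigr do rewrite mulrDr.
rewrite big_split /= addrC; congr (_ + _).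
rewrite (bigD1 j) //= eqxx big1 ?addr0 => [|i /negbTE ->]; last by rewrite mulr0.
by rewrite -scalerAr -mpolyXD -eE.
Qed.

End LinearSubstitution.

Section Simplicial.
Variables (R : realType) (I : finType) (n : nat) (S : fan I n).

Definition combo (c : I -> R) : 'rV[R]_n := \sum_i c i *: rayR R S i.

Definition supported (s : {set I}) (c : I -> R) : Prop :=
  (forall i, 0 <= c i) /\ (forall i, i \notin s -> c i = 0).

Lemma combo_supp s c : supported s c -> combo c = \sum_(i in s) c i *: rayR R S i.
Proof.
move=> [_ c0]; rewrite /combo [RHS]big_mkcond; apply: eq_bigr => i _.
by case: ifPn => // /c0 ->; rewrite scale0r.
Qed.

Lemma coneP s (x : 'rV[R]_n) : cone S s x <-> exists2 c, supported s c & x = combo c.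
Proof.
split=> [[c c0 ->]|[c cs ->]].
  exists (fun i => if i \in s then c i else 0).
    by split=> i; [case: ifP | move/negbTE ->].
  rewrite /combo big_mkcond; apply: eq_bigr => i _.
  by case: ifP => //; rewrite scale0r.
by exists c; [case: cs | exact: combo_supp].
Qed.

Lemma combo_cone s c : supported s c -> cone S s (combo c).
Proof. by move=> cs; apply/coneP; exists c. Qed.

Lemma cone_subset (s t : {set I}) (x : 'rV[R]_n) : s \subset t -> cone S s x -> cone S t x.
Proof.
move=> st /coneP[c [c0 cs] ->]; apply: combo_cone; split=> // i it.
by apply: cs; apply: contraNN it => /(fintype.subsetP st).
Qed.

Lemma cone_scale s (t : R) (x : 'rV[R]_n) : 0 <= t -> cone S s x -> cone S s (t *: x).
Proof.
move=> t0 [c c0 ->]; exists (fun i => t * c i) => [i|]; first exact: mulr_ge0.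
by rewrite scaler_sumr; apply: eq_bigr => i _; rewrite scalerA.
Qed.

Hypothesis Sf : simplicial_fan R S.

Lemma cones0 : finset.set0 \in cones S. Proof. by case: Sf. Qed.

Lemma cones_sub (s t : {set I}) : s \in cones S -> t \subset s -> t \in cones S.
Proof. by case: Sf => _ + _ _ _; apply. Qed.

Lemma cones1 (s : {set I}) i : s \in cones S -> i \in s -> [set i]%SET \in cones S.
Proof. by move=> sS si; apply: (cones_sub sS); rewrite finset.sub1set. Qed.

Lemma coneI (s t : {set I}) (x : 'rV[R]_n) : s \in cones S -> t \in cones S ->
  cone S s x -> cone S t x -> cone S (s :&: t)%SET x.
Proof. by case: Sf => _ _ _ _ + sS tS xs xt; move/(_ s t sS tS) => <-. Qed.

Lemma dual_functional (s : {set I}) (c : I -> R) : s \in cones S ->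
  exists l : 'cV[R]_n, forall i, i \in s -> (rayR R S i *m l) 0 0 = c i.
Proof.
case: Sf => _ _ _ + _ sS => /(_ s sS) rk.
pose M : 'M[R]_(#|s|, n) := \matrix_(k < #|s|) rayR R S (enum_val k).
have MrowE i (si : i \in s) : rayR R S i = row (enum_rank_in si i) M.
  by rewrite rowK enum_rankK_in.
have MS : (M :=: cone_span R S s)%MS.
  apply/eqmxP/andP; split.
    apply/row_subP => k; rewrite rowK.
    by rewrite (sumsmx_sup (enum_val k)) ?enum_valP // genmxE.
  apply/sumsmx_subP => i si; rewrite genmxE.
  by rewrite (MrowE i si) row_sub.
have Mfree : row_free M by rewrite /row_free MS rk.
exists (pinvmx M *m \col_k c (enum_val k)) => i si.
rewrite (MrowE i si) mulmxA -row_mul mulmxVp // -row_mul mul1mx.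
by rewrite !mxE enum_rankK_in.
Qed.

Lemma combo_mul m (c : I -> R) (q : 'M[R]_(n, m)) :
  combo c *m q = \sum_i c i *: (rayR R S i *m q).
Proof. by rewrite mulmx_suml; apply: eq_bigr => i _; rewrite scalemxAl. Qed.

Lemma combo_eval (s : {set I}) (c : I -> R) (l : 'cV[R]_n) (g : I -> R) :
  (forall i, i \notin s -> c i = 0) ->
  (forall i, i \in s -> (rayR R S i *m l) 0 0 = g i) ->
  (combo c *m l) 0 0 = \sum_i c i * g i.
Proof.
move=> cs lg; rewrite combo_mul summxE; apply: eq_bigr => i _; rewrite mxE.
by have [/lg ->//|/cs ->] := boolP (i \in s); rewrite !mul0r.
Qed.

Lemma sum_delta (c : I -> R) i : \sum_j c j * (j == i)%:R = c i.
Proof.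
rewrite (bigD1 i) //= eqxx mulr1 big1 ?addr0 // => j /negbTE ->.
by rewrite mulr0.
Qed.

Lemma combo_inj (s : {set I}) c c' : s \in cones S ->
  (forall i, i \notin s -> c i = 0) -> (forall i, i \notin s -> c' i = 0) ->
  combo c = combo c' -> c = c'.
Proof.
move=> sS cs cs' cc; apply: funext => i.
have [l lE] := @dual_functional s (fun j => (j == i)%:R) sS.
have := combo_eval cs lE; rewrite cc (combo_eval cs' lE).
by rewrite !sum_delta.
Qed.

Definition ray_coord (x : 'rV[R]_n) : I -> R :=
  xget (fun=> 0) [set c | exists2 s, s \in cones S & supported s c /\ x = combo c].

Lemma coord_combo s c : s \in cones S -> supported s c -> ray_coord (combo c) = c.
Proof.
move=> sS cs; rewrite /ray_coord; case: xgetP => [c' _ [t tS [ct cE]]|/(_ c)[]]; last by exists s.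
have /coneP[c'' cI cE'] := coneI sS tS (combo_cone cs) (ltac:(rewrite cE; exact: combo_cone)).
have outI u : supported (s :&: t)%SET u ->
    (forall i, i \notin s -> u i = 0) /\ (forall i, i \notin t -> u i = 0).
  by move=> [_ uI]; split=> i it; apply: uI; rewrite inE negb_and it ?orbT.
have [o1 o2] := outI _ cI.
rewrite (combo_inj tS (proj2 ct) o2); last by rewrite -cE.
by rewrite (combo_inj sS (proj2 cs) o1).
Qed.

Lemma coordK (x : 'rV[R]_n) s : s \in cones S -> cone S s x ->
  supported s (ray_coord x) /\ x = combo (ray_coord x).
Proof. by move=> sS /coneP[c cs ->]; rewrite (coord_combo sS). Qed.

Lemma coord_ge0 (x : 'rV[R]_n) i : 0 <= ray_coord x i.
Proof. by rewrite /ray_coord; case: xgetP => [c _ [s _ [[c0 _] _]]|]. Qed.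

Lemma coord_ray i j : [set i]%SET \in cones S -> ray_coord (rayR R S i) j = (j == i)%:R.
Proof.
move=> iS; have -> : rayR R S i = combo (fun j => (j == i)%:R).
  rewrite /combo (bigD1 i) //= eqxx scale1r big1 ?addr0 // => k /negbTE ->.
  by rewrite scale0r.
rewrite (coord_combo iS) //; split=> k; first exact: ler0n.
by rewrite inE => /negbTE ->.
Qed.

Lemma supp_ray i : [set i]%SET \in cones S -> supp R S (rayR R S i).
Proof.
move=> iS; exists [set i]%SET => //; exists (fun=> 1) => //.
by rewrite big_set1 scale1r.
Qed.

Lemma coord_lin s : s \in cones S -> exists l : I -> 'cV[R]_n,
  forall x, cone S s x -> forall i, ray_coord x i = (x *m l i) 0 0.
Proof.
move=> sS; have [l lE] := choice (fun i => @dual_functional s (fun j => (j == i)%:R) sS).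
exists (fun i => if i \in s then l i else 0) => x xs i.
have [[c0 cs] xE] := coordK sS xs; case: ifPn => [si|/cs ->]; last by rewrite mulmx0 mxE.
by rewrite [in RHS]xE (combo_eval cs (lE i)) sum_delta.
Qed.

Lemma crt_pp i : (fun x : supp R S => ray_coord (val x) i) \in pp_pred (S:=S).
Proof.
apply/asboolP => s /coord_lin[l lE]; exists (lin_mpoly (l i)) => x xs.
by rewrite peval_lin lE.
Qed.

Definition crt i : PP R S := MkPP (crt_pp i).

Lemma crtE i x : crt i x = ray_coord (val x) i. Proof. by []. Qed.

Lemma crt_homog i : pp_homog 1 (crt i).
Proof.
move=> s /coord_lin[l lE]; exists (lin_mpoly (l i)); first exact: lin_mpoly_homog.
by move=> x xs; rewrite peval_lin crtE lE.
Qed.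

Lemma crt_courant i : courant i (crt i).
Proof.
split=> [|j jS x xE]; first exact: crt_homog.
by rewrite crtE xE coord_ray.
Qed.

Lemma suppP (x : supp R S) : exists2 s, s \in cones S & cone S s (val x).
Proof. by case: x => x /= /set_mem. Qed.

Lemma crt_noray i : [set i]%SET \notin cones S -> crt i = 0.
Proof.
move=> iS; apply: PP_ext => x; rewrite crtE.
have [s sS xs] := suppP x; have [[_ cs] _] := coordK sS xs.
by rewrite cs //; apply: contraNN iS => /(cones1 sS).
Qed.

Definition retract (s : {set I}) x : 'rV[R]_n :=
  combo (fun i => if i \in s then ray_coord x i else 0).

Lemma retract_cone (s : {set I}) x : cone S s (retract s x).
Proof.
apply: combo_cone; split=> i; last by move/negbTE ->.
by case: ifP => // _; exact: coord_ge0.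
Qed.

Lemma retract_id (s : {set I}) x : s \in cones S -> cone S s x -> retract s x = x.
Proof.
move=> sS xs; have [[_ cs] xE] := coordK sS xs; rewrite [RHS]xE; congr combo.
by apply: funext => i; case: ifPn => // /cs.
Qed.

Lemma retract_setI (s t : {set I}) x : t \in cones S -> cone S t x ->
  cone S (s :&: t)%SET (retract s x).
Proof.
move=> tS xt; have [[c0 ct] _] := coordK tS xt; apply: combo_cone; split=> i.
  by case: ifP.
by rewrite inE negb_and; case: (i \in s) => //= /ct.
Qed.

Lemma retract_supp (s : {set I}) x : s \in cones S -> supp R S (retract s x).
Proof. by move=> sS; exists s => //; exact: retract_cone. Qed.

Lemma retract_poly (s : {set I}) k (p : {mpoly R[n]}) : p \is k.-homog ->
  exists2 g : PP R S, pp_homog k g & forall x, g x = peval p (retract s (val x)).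
Proof.
move=> ph; apply: pp_homog_exists => t /coord_lin[l lE].
pose M : 'M[R]_n := \sum_(i in s) l i *m rayR R S i.
exists (subst M p); first exact: subst_homog.
move=> x xt; rewrite peval_subst; congr peval.
rewrite /retract /combo mulmx_sumr [RHS]big_mkcond; apply: eq_bigr => i _.
case: ifP => _; last by rewrite scale0r.
by rewrite lE // mulmxA [X in _ = X *m _]mx11_scalar mul_scalar_mx.
Qed.

Definition generated k (f : PP R S) : Prop :=
  exists2 r : I -> PP R S, forall i, pp_homog k (r i) & f = \sum_i crt i * r i.

Lemma generatedD k (f g : PP R S) : generated k f -> generated k g -> generated k (f + g).
Proof.
move=> [r rh ->] [r' rh' ->]; exists (fun i => r i + r' i) => [i|].
  exact: pp_homogD.
by rewrite -big_split; apply: eq_bigr => i _; rewrite mulrDr.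
Qed.

Lemma generated0 k : generated k 0.
Proof.
by exists (fun=> 0) => [i|]; [exact: pp_homog0 | rewrite big1 // => i _; rewrite mulr0].
Qed.

Lemma generated_homog k (f : PP R S) : generated k f -> pp_homog k.+1 f.
Proof.
move=> [r rh ->]; apply: pp_homog_sum => i _.
by apply: (@pp_homogM _ _ _ _ 1) => //; exact: crt_homog.
Qed.

Lemma generated_retract k (f : PP R S) (s : {set I}) : s \in cones S -> pp_homog k.+1 f ->
  exists2 g, generated k g &
    forall x y, val y = retract s (val x) -> g x = f y.
Proof.
move=> sS /(_ s sS)[p ph pE]; have [q qh qE] := homog_split ph.
pose Q i : {mpoly R[n]} := if i \in s then \sum_j (rayR R S i) 0 j *: q j else 0.
have Qh i : Q i \is k.-homog.
  rewrite /Q; case: ifP => _; last exact: dhomog0.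
  by apply: rpred_sum => j _; apply: rpredZ.
have [r rP] := choice (fun i => (let: ex_intro2 g a b := retract_poly s (Qh i) in
   ex_intro (fun g => pp_homog k g /\ _) g (conj a b))).
exists (\sum_i crt i * r i); first by exists r => // i; case: (rP i).
move=> x y yE; rewrite pE; last by rewrite yE; exact: retract_cone.
rewrite PP_sumE qE yE /peval raddf_sum.
under [RHS]eq_bigr do rewrite /= mevalM mevalXU {1}/retract summxE mulr_suml.
rewrite exchange_big; apply: eq_bigr => i _; rewrite PP_mulE crtE (proj2 (rP i)) /Q.
case: ifP => _; last by rewrite /peval meval0 mulr0 big1 // => j _; rewrite !mxE !mul0r.
rewrite /peval raddf_sum mulr_sumr; apply: eq_bigr => j _ /=.
by rewrite mevalZ !mxE mulrA.
Qed.

(* Subtract from [f], by increasing [#|s|], its composites with the simplicial *)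
(* retractions onto the cones [s]: each is a polynomial in Courant functions.  *)
Lemma homogS_generated k (f : PP R S) : pp_homog k.+1 f -> generated k f.
Proof.
move=> fh.
suff step r : exists2 g, generated k (f - g) & pp_homog k.+1 g /\
    forall s, s \in cones S -> (#|s| < r)%N -> forall x, cone S s (val x) -> g x = 0.
  have [g fg [_ g0]] := step #|I|.+1; suff g00 : g = 0 by move: fg; rewrite g00 subr0.
  apply: PP_ext => x; have [s sS xs] := suppP x.
  by apply: (g0 s) => //; rewrite ltnS max_card.
elim: r => [|r [g fg [gh g0]]]; first by exists f; rewrite ?subrr; [exact: generated0|].
have /choice[G GP] : forall s, exists G : PP R S, s \in cones S ->
    generated k G /\ forall x y, val y = retract s (val x) -> G x = g y.
  move=> s; have [sS|sS] := boolP (s \in cones S); last by exists 0.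
  by have [G G1 G2] := generated_retract sS gh; exists G.
pose H := \sum_(s in cones S | #|s| == r) G s.
have Hgen : generated k H.
  rewrite /H; elim/big_ind: _ => [||s /andP[sS _]]; first exact: generated0.
    exact: generatedD.
  by case: (GP s sS).
exists (g - H).
  by rewrite opprB addrCA addrC; exact: generatedD.
split=> [|s sS sr x xs].
  by apply: pp_homogD => //; apply: pp_homogN; exact: generated_homog.
rewrite PP_addE PP_oppE PP_sumE.
have Gx t : t \in cones S -> #|t| == r -> t != s -> G t x = 0.
  move=> tS tr ts.
  pose y : supp R S := SigSub (mem_set (retract_supp (val x) tS)).
  rewrite (proj2 (GP t tS) x y erefl).
  apply: (g0 (t :&: s)%SET); last by exact: retract_setI.
    by apply: (cones_sub sS); rewrite finset.subsetIr.
  rewrite -(eqP tr); apply: proper_card; rewrite properE finset.subsetIl /= finset.subsetI subxx /=.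
  by apply: contraNN ts => ts; rewrite eqEcard ts (eqP tr) -ltnS.
have [sr'|sr'] := eqVneq #|s| r.
  rewrite (bigD1 s) ?sS ?sr' ?eqxx //= big1 ?addr0; last first.
    by move=> t /andP[/andP[tS tr] ts]; exact: Gx.
  rewrite (proj2 (GP s sS) x x) ?subrr //.
  by rewrite retract_id.
rewrite (g0 s) ?big1 ?subr0 //; last by rewrite ltn_neqAle sr' -ltnS.
move=> t /andP[tS tr]; apply: Gx => //.
by apply: contraNneq sr' => <-.
Qed.

Lemma homog0_const (f : PP R S) : pp_homog 0 f -> exists c, f = const S c.
Proof.
have z0 : supp R S 0.
  by exists finset.set0; [exact: cones0 | exists (fun=> 0) => //; rewrite big_set0].
pose z : supp R S := SigSub (mem_set z0).
move=> fh; exists (f z); apply: PP_ext => x; have [s sS xs] := suppP x.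
have [p /dhomogP ph pE] := fh s sS.
have zs : cone S s (0 : 'rV[R]_n) by exists (fun=> 0) => //; rewrite big1 // => i _; rewrite scale0r.
have pc : p = (p@_0%MM)%:MP.
  apply/mpolyP => e; rewrite mcoeffC; case: eqP => [<-|/eqP e0]; first by rewrite mulr1.
  rewrite mulr0; apply/eqP; rewrite mcoeff_eq0; apply: contraNN e0 => /ph /= /eqP.
  by rewrite mdeg_eq0 eq_sym.
by rewrite [RHS](pE z zs) (pE x xs) pc /peval !mevalC.
Qed.

Lemma chow_gen k a : chow_deg R S k.+1 a ->
  exists2 r : I -> chow R S, forall i, chow_deg R S k (r i) &
    a = \sum_i class (crt i) * r i.
Proof.
move=> [f /homogS_generated[r rh ->] <-]; exists (fun i => class (r i)) => [i|].
  by exists (r i).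
by rewrite class_sum; apply: eq_bigr => i _; rewrite classM.
Qed.

Lemma chow_deg0_scalar a : chow_deg R S 0 a -> exists c : R, a = c *: (1 : chow R S).
Proof.
move=> [f /homog0_const[c ->] <-]; exists c.
by rewrite chow_scaleE mulr1.
Qed.

Lemma crt_deg i : chow_deg R S 1 (class (crt i)).
Proof. by exists (crt i) => //; exact: crt_homog. Qed.

Lemma homog1_crt (f : PP R S) (c : I -> R) : pp_homog 1 f ->
  (forall i, [set i]%SET \in cones S -> forall x, val x = rayR R S i -> f x = c i) ->
  f = \sum_i const S (c i) * crt i.
Proof.
move=> fh fc; have [r rh fE] := homogS_generated fh.
rewrite fE; apply: eq_bigr => i _.
have [iS|/crt_noray ->] := boolP ([set i]%SET \in cones S); last by rewrite mul0r mulr0.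
have [d rE] := homog0_const (rh i); rewrite rE mulrC; congr (const S _ * _).
have := fc i iS (SigSub (mem_set (supp_ray iS))) erefl.
rewrite fE PP_sumE (bigD1 i) // big1 => [|j ji].
  by rewrite PP_mulE crtE coord_ray // eqxx mul1r rE => <-; exact/esym/addr0.
by rewrite PP_mulE crtE coord_ray // (negbTE (ji : j != i)) mul0r.
Qed.

End Simplicial.

(** * Lattices, quotients and stars *)

Section Content.
Variable n : nat.
Implicit Types v : 'rV[int]_n.

Lemma content_dvd v j : ((content v)%:Z %| v 0%R j)%Z.
Proof.
rewrite /content dvdzE absz_nat (bigD1 j) //=; exact: dvdn_gcdl.
Qed.

Lemma contentE v : v = (content v)%:Z *: primitive_part v.
Proof. by apply/rowP => j; rewrite !mxE mulrC divzK // content_dvd. Qed.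

Lemma contentZ (a : nat) v : content (a%:Z *: v) = (a * content v)%N.
Proof.
rewrite /content (big_morph (muln a) (id1 := 0%N) (op1 := gcdn)) ?muln0 //.
  by apply: eq_bigr => j _; rewrite mxE abszM.
by move=> x y; rewrite muln_gcdr.
Qed.

Lemma content_eq0 v : content v = 0%N -> v = 0.
Proof. by move=> c0; rewrite (contentE v) c0 scale0r. Qed.

Lemma content_primitive v : v != 0 -> content (primitive_part v) = 1%N.
Proof.
move=> v0; have c0 : (0 < content v)%N.
  by rewrite lt0n; apply: contraNneq v0 => /content_eq0 ->.
have := contentZ (content v) (primitive_part v); rewrite -contentE => /eqP.
by rewrite -{1}[content v]muln1 eqn_pmul2l // => /eqP <-.
Qed.

Lemma primitive_partZ (a : nat) v : (0 < a)%N ->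
  primitive_part (a%:Z *: v) = primitive_part v.
Proof.
move=> a0; apply/rowP => j; rewrite !mxE contentZ PoszM divzMpl //.
Qed.

End Content.

Section EquivalenceRepresentatives.

Lemma representatives (T : eqType) (e : T -> T -> Prop) (E : seq T) :
  (forall x, e x x) -> (forall x y, e x y -> e y x) ->
  exists E' : seq T, [/\ uniq E', {subset E' <= E},
    (forall x y, x \in E' -> y \in E' -> e x y -> x = y) &
    (forall x, x \in E -> exists2 y, y \in E' & e x y)].
Proof.
move=> erefl esym; elim: E => [|x E [E' [E'u E'E E'e EE']]].
  by exists [::]; split.
have [[y yE' xy]|noy] := pselect (exists2 y, y \in E' & e x y).
  exists E'; split=> // [z /E'E zE|z]; first by rewrite inE zE orbT.
  by rewrite inE => /orP[/eqP ->|/EE' //]; exists y.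
exists (x :: E'); split.
- rewrite /= E'u andbT; apply/negP => xE'; apply: noy; exists x => //.
- by move=> z; rewrite !inE => /orP[->//|/E'E ->]; rewrite orbT.
- move=> y z; rewrite !inE => /orP[/eqP ->|yE] /orP[/eqP ->|zE] //.
  + by move=> xz; case: noy; exists z.
  + by move=> yx; case: noy; exists y => //; exact: esym.
  + exact: E'e.
- move=> z; rewrite inE => /orP[/eqP ->|/EE' [y yE zy]].
    by exists x; rewrite ?inE ?eqxx.
  by exists y => //; rewrite inE yE orbT.
Qed.

End EquivalenceRepresentatives.

Section ConeSpan.
Variables (R : realType) (I : finType) (n : nat) (S : fan I n).

Lemma cone_spanP (s : {set I}) (x : 'rV[R]_n) :
  (x <= cone_span R S s)%MS <-> exists c : I -> R, x = \sum_(i in s) c i *: rayR R S i.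
Proof.
split=> [/sub_sumsmxP[u ->]|[c ->]].
  have /choice[c cE] i : exists c, u i *m <<rayR R S i>>%MS = c *: rayR R S i.
    by apply/sub_rVP; rewrite (submx_trans (submxMl _ _)) // genmxE.
  by exists c; apply: eq_bigr.
apply: summx_sub_sums => i _; rewrite genmxE; exact: scalemx_sub.
Qed.

Lemma ray_span (s : {set I}) i : i \in s -> (rayR R S i <= cone_span R S s)%MS.
Proof. by move=> si; rewrite (sumsmx_sup i) // genmxE. Qed.

Lemma multiplicity_exists (s : {set I}) : exists2 m, (0 < m)%N & multiplicity R S s m.
Proof.
pose P (v : 'rV[int]_n) := `[< (map_mx intr v <= cone_span R S s)%MS >].
pose e (v w : 'rV[int]_n) := exists c : I -> int, v - w = \sum_(i in s) c i *: ray S i.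
have erefl v : e v v.
  by exists (fun=> 0); rewrite subrr big1 // => i _; rewrite scale0r.
have esym v w : e v w -> e w v.
  move=> [c vw]; exists (fun i => - c i); rewrite -opprB vw -sumrN.
  by apply: eq_bigr => i _; rewrite scaleNr.
have etrans v w z : e v w -> e w z -> e v z.
  move=> [c vw] [c' wz]; exists (fun i => c i + c' i).
  rewrite -(subrK w v) -addrA vw wz -big_split.
  by apply: eq_bigr => i _; rewrite scalerDl.
pose K := (\sum_i \sum_j `|ray S i 0%R j|)%N.
pose box (f : {ffun 'I_n -> 'I_(K + K).+1}) : 'rV[int]_n := \row_j ((f j : nat)%:Z - K%:Z).
pose E := [seq v <- [seq box f | f : {ffun 'I_n -> 'I_(K + K).+1}] | P v].
have boxP v : P v -> exists2 w, w \in E & e v w.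
  move=> /asboolP Pv; have /cone_spanP[r vE] := Pv.
  pose z i := Num.floor (r i); pose w := v - \sum_(i in s) z i *: ray S i.
  have wE : map_mx intr w = \sum_(i in s) (r i - (z i)%:~R) *: rayR R S i.
    rewrite /w map_mxB vE raddf_sum -sumrB; apply: eq_bigr => i _.
    by rewrite /= scalerBl map_mxZ.
  exists w; last by exists z; rewrite /w opprB addrC subrK.
  rewrite mem_filter; apply/andP; split.
    apply/asboolP; rewrite wE; apply/cone_spanP.
    by exists (fun i => r i - (z i)%:~R).
  have wK j : `|w 0 j| <= K%:Z.
    rewrite -(ler_int R) intr_norm; have -> : (w 0 j)%:~R = (map_mx intr w : 'rV[R]_n) 0 j by rewrite [RHS]mxE.
    rewrite wE summxE (le_trans (ler_norm_sum _ _ _)) // -pmulrn /K natr_sum.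
    rewrite [leLHS]big_mkcond /= ler_sum // => i _; case: ifP => _; last exact: ler0n.
    rewrite mxE normrM natr_sum (bigD1 j) //=.
    have r1 : `|r i - (z i)%:~R| <= 1.
      have := floor_itv (r i); rewrite intrD => /andP[h1 h2].
      by rewrite ger0_norm ?subr_ge0 // lerBlDl ltW.
    rewrite (le_trans (ler_wpM2r (normr_ge0 _) r1)) // mul1r.
    rewrite -[leLHS]addr0 lerD ?sumr_ge0 // !mxE.
    by rewrite natr_absz intr_norm.
  apply/mapP; have fK j : (absz (w 0%R j + K%:Z)%R < (K + K).+1)%N.
    by have := wK j; lia.
  exists [ffun j => Ordinal (fK j)]; first by rewrite mem_enum.
  apply/rowP => j; rewrite [RHS]mxE ffunE /=; have := wK j; move: (w 0 j) => a aK; rewrite gez0_abs; lia.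
have [E' [E'u E'E E'e EE']] := representatives E erefl esym.
have E'P v : P v -> exists2 w, w \in E' & e v w.
  by move=> /boxP[w wE vw]; have [y yE wy] := EE' w wE; exists y => //; exact: etrans wy.
exists (size E').
  have [|w wE' _] := E'P 0; last by case: (E') wE'.
  by apply/asboolP; rewrite map_mx0 sub0mx.
exists (fun j => nth 0 E' j) => [j|v /asboolP Pv].
  by have := E'E _ (mem_nth 0 (ltn_ord j)); rewrite mem_filter => /andP[/asboolP].
have [w wE' vw] := E'P v Pv; have wi : (index w E' < size E')%N by rewrite index_mem.
exists (Ordinal wi); split=> [|j vj]; first by rewrite /= nth_index.
apply/val_inj/eqP; rewrite /= -(nth_uniq 0 wi (ltn_ord j) E'u) nth_index //.
apply/eqP/E'e => //; first exact: mem_nth.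
exact: etrans (esym _ _ vw) vj.
Qed.

End ConeSpan.

Section Quotient.
Variables (R : realType) (I : finType) (n : nat) (S : fan I n).
Variables (s : {set I}) (m : nat) (q : 'M[int]_(n, m)).
Hypothesis hq : quotient_by R S s q.
Let qR : 'M[R]_(n, m) := map_mx intr q.

Lemma quotient_section : exists u : 'M[int]_(m, n), u *m q = 1%:M.
Proof.
have /choice[u uE] k : exists v, v *m q = row k 1%:M by exact: (proj1 hq).
exists (\matrix_k u k); apply/row_matrixP => k.
by rewrite row_mul rowK uE.
Qed.

Lemma quotient_ker (x : 'rV[R]_n) : x *m qR = 0 <-> (x <= cone_span R S s)%MS.
Proof.
split=> [xq|/cone_spanP[c ->]]; last first.
  rewrite mulmx_suml big1 // => i si; rewrite -scalemxAl.
  have /(proj2 hq) h : (map_mx intr (ray S i) <= cone_span R S s)%MS by exact: ray_span.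
  by rewrite /rayR /qR -map_mxM h map_mx0 scaler0.
have [u uq] := quotient_section.
have -> : x = x *m map_mx intr (1%:M - q *m u).
  by rewrite map_mxB map_mx1 map_mxM mulmxBr mulmx1 mulmxA xq mul0mx subr0.
apply: (submx_trans (submxMl _ _)); apply/row_subP => k; rewrite -map_row.
apply/(proj2 hq); rewrite -row_mul mulmxBl mul1mx -mulmxA uq mulmx1 subrr.
by rewrite row0.
Qed.

Lemma quotient_lift (l : 'cV[R]_n) : (forall i, i \in s -> (rayR R S i *m l) 0 0 = 0) ->
  exists l' : 'cV[R]_m, qR *m l' = l.
Proof.
move=> l0; have [u uq] := quotient_section.
exists (map_mx intr u *m l); apply/row_matrixP => k.
apply/eqP; rewrite -subr_eq0 -linearB /= mulmxA -[X in _ - X]mul1mx -mulmxBl row_mul.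
have : (row k (qR *m map_mx intr u - 1%:M) <= cone_span R S s)%MS.
  apply/quotient_ker; rewrite -row_mul mulmxBl mul1mx -mulmxA -map_mxM uq map_mx1 mulmx1.
  by rewrite subrr row0.
move=> /cone_spanP[c ->]; apply/eqP/rowP => j; rewrite ord1 mulmx_suml summxE big1 ?mxE //.
by move=> i si; rewrite -scalemxAl mxE l0 // mulr0.
Qed.

End Quotient.

Section StarRay.
Variables (R : realType) (I : finType) (n : nat) (S : fan I n).
Hypothesis Sf : simplicial_fan R S.
Variables (i : I) (m : nat) (q : 'M[int]_(n, m)).
Hypothesis iS : [set i]%SET \in cones S.
Hypothesis hq : quotient_by R S [set i]%SET q.
Let qR : 'M[R]_(n, m) := map_mx intr q.
Let S' := star S [set i]%SET q.

Definition ray_mult (j : I) : nat := content (ray S j *m q).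

Lemma star_conesP (t : {set I}) : (t \in cones S') = (i \notin t) && (i |: t \in cones S)%SET.
Proof.
apply/imsetP/andP => [[t' + ->]|[it tS]].
  rewrite inE finset.sub1set => /andP[tS it]; rewrite !inE eqxx; split=> //.
  by rewrite finset.setD1K.
exists (i |: t)%SET; first by rewrite inE tS finset.sub1set !inE eqxx.
by rewrite finset.setU1K.
Qed.

Lemma star_cones_sub (t : {set I}) : t \in cones S' -> t \in cones S.
Proof.
by rewrite star_conesP => /andP[_ tS]; apply: (cones_sub Sf tS); rewrite finset.subsetUr.
Qed.

Lemma rayR_star j : rayR R S j *m qR = (ray_mult j)%:R *: rayR R S' j.
Proof.
rewrite /rayR -map_mxM {1}(contentE (ray S j *m q)) map_mxZ.
by congr (_ *: _).
Qed.

Lemma rayR_star_i : rayR R S i *m qR = 0.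
Proof. by apply/(quotient_ker hq)/ray_span; rewrite inE. Qed.

Lemma ker_ray (x : 'rV[R]_n) : x *m qR = 0 -> exists a, x = a *: rayR R S i.
Proof.
move=> /(quotient_ker hq)/cone_spanP[c ->]; exists (c i).
by rewrite finset.big_set1.
Qed.

Lemma ray_mult_neq0 j (t : {set I}) : j \in t -> t \in cones S' -> ray S j *m q != 0.
Proof.
move=> jt; rewrite star_conesP => /andP[it tS]; apply/eqP => jq.
have [l lE] := dual_functional Sf (fun k => (k == j)%:R : R) tS.
have [a aE] : exists a, rayR R S j = a *: rayR R S i.
  by apply: ker_ray; rewrite /rayR -map_mxM jq map_mx0.
have := lE j; rewrite !inE jt orbT aE -scalemxAl mxE lE ?inE ?eqxx // => /(_ isT).
have ij : i == j = false by apply: contraNF it => /eqP ->.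
by rewrite ij mulr0 => /esym/eqP; rewrite oner_eq0.
Qed.

Lemma ray_mult_gt0 j (t : {set I}) : j \in t -> t \in cones S' -> (0 < ray_mult j)%N.
Proof.
move=> jt tS; rewrite lt0n; apply: contraNneq (ray_mult_neq0 jt tS).
by move/content_eq0 ->.
Qed.

Lemma push_combo (c : I -> R) :
  combo S c *m qR = combo S' (fun j => if j == i then 0 else c j * (ray_mult j)%:R).
Proof.
rewrite combo_mul; apply: eq_bigr => j _; case: eqP => [->|_].
  by rewrite rayR_star_i scaler0 scale0r.
by rewrite rayR_star scalerA.
Qed.

Lemma supported_push (t : {set I}) (c : I -> R) : supported t c ->
  supported (t :\ i)%SET (fun j => if j == i then 0 else c j * (ray_mult j)%:R).
Proof.
move=> [c0 ct]; split=> j.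
  by case: ifP => // _; rewrite mulr_ge0 ?ler0n.
by rewrite !inE negb_and negbK; case: (j == i) => //= /ct ->; rewrite mul0r.
Qed.

Lemma cone_push (t : {set I}) (x : 'rV[R]_n) : cone S t x -> cone S' (t :\ i)%SET (x *m qR).
Proof. by move=> /coneP[c ct ->]; rewrite push_combo; exact/combo_cone/supported_push. Qed.

Lemma cones_push (t : {set I}) : (i |: t)%SET \in cones S -> (t :\ i)%SET \in cones S'.
Proof.
move=> tS; rewrite star_conesP !inE eqxx /=.
rewrite (_ : (i |: t :\ i)%SET = (i |: t)%SET) //.
by apply/finset.setP => j; rewrite !inE; case: (j == i).
Qed.

Lemma cone_lift (t : {set I}) (y : 'rV[R]_m) : t \in cones S' -> cone S' t y ->
  exists2 x, cone S t x & x *m qR = y.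
Proof.
move=> tS /coneP[c [c0 ct] ->].
have it : i \notin t by move: tS; rewrite star_conesP => /andP[].
exists (combo S (fun j => c j / (ray_mult j)%:R)).
  apply: combo_cone; split=> [j|j /ct ->]; last by rewrite mul0r.
  by rewrite divr_ge0 ?ler0n.
rewrite push_combo; congr combo; apply: funext => j.
case: eqP => [->|_]; first by rewrite ct.
have [jt|/ct ->] := boolP (j \in t); last by rewrite !mul0r.
by rewrite divfK // pnatr_eq0 -lt0n (ray_mult_gt0 jt).
Qed.

Lemma coneI_star (s t : {set I}) (x y : 'rV[R]_n) : s \in cones S' -> t \in cones S' ->
  cone S s x -> cone S t y -> x *m qR = y *m qR -> cone S' (s :&: t)%SET (x *m qR).
Proof.
wlog: s t x y / exists2 a, 0 <= a & x = y + a *: rayR R S i.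
  move=> H sS tS xs yt xy.
  have [a aE] : exists a, x - y = a *: rayR R S i.
    by apply: ker_ray; rewrite mulmxBl xy subrr.
  have [a0|a0] := leP 0 a.
    by apply: (H s t x y) => //; exists a => //; rewrite -aE addrC subrK.
  rewrite xy finset.setIC; apply: (H t s y x) => //.
  by exists (- a); rewrite ?oppr_ge0 ?ltW // scaleNr -aE opprB addrC subrK.
move=> [a a0 xE] sS tS xs yt _.
move: (sS) (tS); rewrite !star_conesP => /andP[is_ sS'] /andP[it tS'].
have xt : cone S (i |: t)%SET x.
  move/coneP: yt => [c [c0 ct] yE]; apply/coneP.
  exists (fun j => if j == i then a else c j).
    split=> j; first by case: ifP.
    by rewrite !inE negb_or; case: (j == i) => //= /ct.
  rewrite xE yE /combo (bigD1 i) //= [in RHS](bigD1 i) //= eqxx (ct i it) scale0r add0r addrC.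
  by congr (_ + _); apply: eq_bigr => j /negbTE ->.
have := cone_push (coneI Sf (star_cones_sub sS) tS' xs xt).
congr (cone _ _ _); apply/finset.setP => j; rewrite !inE.
by case: eqP => [->|] //=; rewrite (negbTE is_).
Qed.

Lemma free_rank k (T : fan I k) (s : {set I}) :
  (forall j, j \in s -> exists l : 'cV[R]_k, forall j', j' \in s ->
     (rayR R T j' *m l) 0 0 = (j' == j)%:R) ->
  \rank (cone_span R T s) = #|s|.
Proof.
move=> dual; pose M : 'M[R]_(#|s|, k) := \matrix_(a < #|s|) rayR R T (enum_val a).
have MS : (M :=: cone_span R T s)%MS.
  apply/eqmxP/andP; split.
    by apply/row_subP => a; rewrite rowK ray_span // enum_valP.
  apply/sumsmx_subP => j sj; rewrite genmxE.
  by rewrite -(enum_rankK_in sj sj) -[rayR _ _ _](rowK (fun a => rayR R T (enum_val a))) row_sub.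
rewrite -MS; apply/eqP; apply/row_freeP.
have /choice[l lE] : forall a : 'I_#|s|, exists l : 'cV[R]_k, forall j', j' \in s ->
     (rayR R T j' *m l) 0 0 = (j' == enum_val a)%:R.
  by move=> a; apply: dual; exact: enum_valP.
exists (\matrix_(b, a) l a b 0); apply/matrixP => a b; rewrite !mxE.
have := lE b _ (enum_valP a); rewrite mxE (inj_eq enum_val_inj) => <-.
by apply: eq_bigr => c _; rewrite !mxE.
Qed.

Lemma star_simplicial : simplicial_fan R S'.
Proof.
split.
- by rewrite star_conesP inE finset.setU0 iS.
- move=> s t; rewrite !star_conesP => /andP[is_ sS] ts; apply/andP; split.
    by apply: contraNN is_ => /(fintype.subsetP ts).
  by apply: (cones_sub Sf sS); apply: finset.setUS.
- move=> j jS; apply: content_primitive; apply: (ray_mult_neq0 (t := [set j]%SET)) => //.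
  by rewrite inE.
- move=> s sS; apply: free_rank => j js.
  move: (sS); rewrite star_conesP => /andP[is_ sS'].
  have [l lE] := dual_functional Sf (fun k => (k == j)%:R : R) sS'.
  have [k|l' l'E] := quotient_lift hq (l := l).
    by rewrite inE => /eqP ->; rewrite lE ?inE ?eqxx // (negbTE (contraNneq _ is_)) // => ->.
  exists ((ray_mult j)%:R *: l') => k ks.
  have := lE k; rewrite !inE ks orbT -l'E mulmxA rayR_star => /(_ isT).
  rewrite -scalemxAl -scalemxAr !mxE; case: eqP => [->|kj] //.
  move/eqP; rewrite mulf_eq0 pnatr_eq0 eqn0Ngt (ray_mult_gt0 ks sS) /= => /eqP h.
  by rewrite [X in _ * X](_ : _ = 0) ?mulr0 // -h mxE.
- move=> s t sS tS; apply/seteqP; split=> [y [ys yt]|y yI].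
    have [x xs xE] := cone_lift sS ys; have [x' xt x'E] := cone_lift tS yt.
    by rewrite -xE; apply: (coneI_star sS tS xs xt); rewrite xE x'E.
  by split; apply: cone_subset yI; rewrite ?finset.subsetIl ?finset.subsetIr.
Qed.

Lemma coord_push (t : {set I}) (x : 'rV[R]_n) j : (i |: t)%SET \in cones S -> cone S t x ->
  ray_coord S' (x *m qR) j = if j == i then 0 else ray_coord S x j * (ray_mult j)%:R.
Proof.
move=> tS xt; have tS' : t \in cones S.
  by apply: (cones_sub Sf tS); rewrite finset.subsetUr.
have [xs xE] := coordK Sf tS' xt.
rewrite [in LHS]xE push_combo (coord_combo star_simplicial (cones_push tS)) //.
exact: supported_push.
Qed.

End StarRay.

Lemma quotient_exists (R : realType) (I : finType) n (S : fan I n) (i : I) :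
  simplicial_fan R S -> [set i]%SET \in cones S ->
  exists m (q : 'M[int]_(n, m)), quotient_by R S [set i]%SET q.
Proof.
move=> Sf iS; have c1 : content (ray S i) = 1%N by case: Sf => _ _ + _ _; apply.
case: n S Sf iS c1 => [|n] S Sf iS c1.
  by move: c1; rewrite /content big_ord0.
have [L Lu [P Pu [d _ vE]]] := int_Smith_normal_form (ray S i).
pose a := L 0 0 * d`_0.
have aE : ray S i *m invmx P = \row_j (a *+ (j == 0)).
  rewrite vE mulmxK //; apply/rowP => j; rewrite !mxE big_ord1 !mxE /=.
  by rewrite -mulrnAr eq_sym.
have a0 : a != 0.
  apply/eqP => a0; have : ray S i = 0.
    rewrite -(mulmxKV Pu (ray S i)) aE a0; rewrite (_ : (\row_j _) = 0) ?mul0mx //.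
    by apply/rowP => j; rewrite !mxE mul0rn.
  by move=> r0; move: c1; rewrite r0 /content big1 // => j _; rewrite mxE.
exists n, (invmx P *m (\matrix_(j, k) (j == lift ord0 k)%:R)).
have qE (v : 'rV[int]_n.+1) (k : 'I_n) :
    (v *m (invmx P *m (\matrix_(j, k) (j == lift ord0 k)%:R))) 0 k = (v *m invmx P) 0 (lift ord0 k).
  rewrite mulmxA mxE (bigD1 (lift ord0 k)) //= [X in _ * X + _]mxE eqxx mulr1 big1 ?addr0 // => j jk.
  by rewrite [X in _ * X]mxE (negbTE jk) mulr0.
split=> [w|v].
  exists (row_mx (0 : 'rV_1) w *m P); apply/rowP => k.
  rewrite qE mulmxK //; rewrite (_ : lift ord0 k = rshift 1 k); last by apply: ord_inj.
  exact: row_mxEr.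
pose PR : 'M[R]_n.+1 := map_mx intr P; pose PVR : 'M[R]_n.+1 := map_mx intr (invmx P).
have PPV : PVR *m PR = 1%:M by rewrite -map_mxM mulVmx // map_mx1.
split=> [v0|/cone_spanP[c]].
  apply/cone_spanP; exists (fun=> ((v *m invmx P) 0 0)%:~R / a%:~R); rewrite finset.big_set1.
  have vE' : v *m invmx P = (v *m invmx P) 0 0 *: \row_j ((j == 0)%:R).
    apply/rowP => j; rewrite [RHS]mxE [X in _ * X]mxE; have [k ->|->] := unliftP ord0 j.
      rewrite [_ == 0]eq_sym (negbTE (neq_lift _ _)) mulr0.
      have := congr1 (fun w : 'rV_n => w 0 k) v0.
      by rewrite qE [X in _ = X]mxE.
    by rewrite eqxx mulr1.
  have -> : map_mx intr v = map_mx intr (v *m invmx P) *m PR.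
    by rewrite map_mxM -mulmxA PPV mulmx1.
  rewrite {1}vE' map_mxZ -scalemxAl.
  have -> : rayR R S i = map_mx intr (ray S i *m invmx P) *m PR.
    by rewrite map_mxM -mulmxA PPV mulmx1.
  rewrite aE.
  have -> : map_mx intr (\row_j (a *+ (j == 0))) = a%:~R *: map_mx intr (\row_j ((j == 0)%:R : int)) :> 'rV[R]_n.+1.
    by apply/rowP => j; rewrite !mxE; case: (j == 0); rewrite ?mulr1 ?mulr0 ?mulr0n.
  by rewrite -scalemxAl scalerA divfK // intr_eq0.
rewrite finset.big_set1 => vE'; apply/rowP => k; rewrite qE [RHS]mxE.
have : map_mx intr (v *m invmx P) 0 (lift ord0 k) = 0 :> R.
  rewrite map_mxM vE' -scalemxAl /rayR -map_mxM aE !mxE.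
  by rewrite eq_sym (negbTE (neq_lift _ _)) mulr0.
by rewrite mxE => /eqP; rewrite intr_eq0 => /eqP.
Qed.

(** * Restriction to the star of a ray *)

Section Homogeneity.
Variables (R : realType).

Lemma peval_scale n (p : {mpoly R[n]}) k (t : R) (x : 'rV[R]_n) : p \is k.-homog ->
  peval p (t *: x) = t ^+ k * peval p x.
Proof.
move=> /dhomogP ph; rewrite /peval !mevalE mulr_sumr big_seq [RHS]big_seq.
apply: eq_bigr => e /ph /= <-; rewrite mulrCA; congr (_ * _).
under eq_bigr do rewrite mxE exprMn.
by rewrite big_split /= prodrXr -mdegE.
Qed.

Lemma peval_line n (p : {mpoly R[n]}) (x : 'rV[R]_n) :
  exists U : {poly R}, forall t, U.[t] = peval p (t *: x).
Proof.
exists (\sum_(e <- msupp p) p@_e *: \prod_i (x 0 i *: 'X) ^+ e i) => t.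
rewrite /peval mevalE horner_sum; apply: eq_bigr => e _.
rewrite hornerZ horner_prod; congr (_ * _); apply: eq_bigr => i _.
by rewrite horner_exp hornerZ hornerX mxE mulrC.
Qed.

Lemma poly_pos_roots (U : {poly R}) : (forall t, 0 < t -> U.[t] = 0) -> U = 0.
Proof.
move=> U0; apply: contraTeq isT => Un0.
pose rs := [seq k.+1%:R : R | k <- iota 0 (size U)].
have rsu : uniq rs by rewrite map_inj_uniq ?iota_uniq // => a b /eqP; rewrite eqr_nat => /eqP[].
have := max_poly_roots Un0 _ rsu; rewrite size_map size_iota ltnn; apply.
by apply/allP => _ /mapP[k _ ->]; apply/rootP/U0; rewrite ltr0n.
Qed.

Variables (I : finType) (n : nat) (S : fan I n).

Lemma homog_at0 k (f : PP R S) (x : supp R S) : pp_homog k.+1 f -> val x = 0 -> f x = 0.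
Proof.
move=> fh x0; have [s sS xs] := suppP x; have [p ph pE] := fh s sS.
by rewrite pE // x0 -(scale0r 0) (peval_scale _ _ ph) expr0n mul0r.
Qed.

(* Compare the linear terms along each half-line: only the values of the      *)
(* cofactors at the origin matter.                                            *)
Lemma lin_ideal_homog1 (f : PP R S) : f \in lin_ideal (S:=S) -> pp_homog 1 f ->
  exists l : 'cV[R]_n, f = lin S l.
Proof.
move=> /asboolP[e fE] fh.
have [[x0]|nox] := pselect (exists x : supp R S, True); last first.
  by exists 0; apply: PP_ext => x; case: nox; exists x.
have z0 : supp R S 0.
  have [s sS _] := suppP x0; exists s => //.
  by exists (fun=> 0) => //; rewrite big1 // => i _; rewrite scale0r.
pose z : supp R S := SigSub (mem_set z0) => _.
exists (\sum_(p <- e) p.2 z *: p.1); apply: PP_ext => x.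
have [s sS xs] := suppP x; have [pf pfh pfE] := fh s sS.
have /choice[U UE] (p : 'cV[R]_n * PP R S) : exists U : {poly R},
    forall t, 0 <= t -> forall y : supp R S, val y = t *: val x -> p.2 y = U.[t].
  have [p2 p2E] : exists p2, forall y : supp R S, cone S s (val y) -> p.2 y = peval p2 (val y).
    by case: p => _ [p2 /= /asboolP/(_ s sS)].
  have [U UE] := peval_line p2 (val x); exists U => t t0 y yE.
  by rewrite UE p2E yE //; exact: cone_scale.
pose V := \sum_(p <- e) (val x *m p.1) 0 0 *: U p - (f x)%:P.
have V0 : V = 0.
  apply: poly_pos_roots => t t0.
  have tx : supp R S (t *: val x) by exists s => //; apply: cone_scale => //; exact: ltW.
  pose y : supp R S := SigSub (mem_set tx).
  have : f y = t * f x.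
    by rewrite !pfE ?(peval_scale _ _ pfh) ?expr1 //=; apply: cone_scale => //; exact: ltW.
  rewrite {1}fE PP_sumE /V hornerD hornerN hornerC horner_sum.
  under eq_bigr => p _ do rewrite PP_mulE (UE p t (ltW t0) y erefl) /= -scalemxAl mxE -mulrA.
  rewrite -mulr_sumr => /(mulfI (lt0r_neq0 t0)) <-.
  apply/eqP; rewrite subr_eq0; apply/eqP; apply: eq_bigr => p _.
  by rewrite hornerZ.
have := congr1 (horner^~ 0) V0; rewrite /V hornerD hornerN hornerC horner0 horner_sum.
move/eqP; rewrite subr_eq0 => /eqP <-; rewrite /= mulmx_sumr summxE.
apply: eq_bigr => p _; rewrite hornerZ -scalemxAr [RHS]mxE mulrC; congr (_ * _).
by rewrite (UE p 0 (lexx 0) z) //= scale0r.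
Qed.

End Homogeneity.

Section Pullback.
Variables (R : realType) (I : finType) (n1 n2 : nat) (S1 : fan I n1) (S2 : fan I n2).
Variable q : 'M[R]_(n1, n2).

Definition cone_map : Prop := forall s, s \in cones S1 ->
  exists2 t, t \in cones S2 & forall x : 'rV[R]_n1, cone S1 s x -> cone S2 t (x *m q).

Hypothesis qS : cone_map.

Lemma pull_supp (x : supp R S1) : supp R S2 (val x *m q).
Proof.
have [s sS xs] := suppP x; have [t tS st] := qS sS.
by exists t => //; exact: st.
Qed.

Definition pull_pt (x : supp R S1) : supp R S2 := SigSub (mem_set (pull_supp x)).

Lemma pull_pp (g : PP R S2) : g \o pull_pt \in pp_pred (S:=S1).
Proof.
apply/asboolP => s sS; have [t tS st] := qS sS.
case: g => g /= /asboolP/(_ t tS)[p pE].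
by exists (subst q p) => x xs; rewrite peval_subst; apply: pE; exact: st.
Qed.

Definition pull (g : PP R S2) : PP R S1 := MkPP (pull_pp g).

Lemma pullE g x y : val x *m q = val y -> pull g x = g y.
Proof. by move=> xy; rewrite /pull /=; congr (pp_fun g _); exact: val_inj. Qed.

Lemma pull_homog k g : pp_homog k g -> pp_homog k (pull g).
Proof.
move=> gh s sS; have [t tS st] := qS sS; have [p ph pE] := gh t tS.
exists (subst q p); first exact: subst_homog.
by move=> x xs; rewrite peval_subst; apply: pE; exact: st.
Qed.

Lemma pullD g g' : pull (g + g') = pull g + pull g'. Proof. exact: PP_ext. Qed.
Lemma pullM g g' : pull (g * g') = pull g * pull g'. Proof. exact: PP_ext. Qed.
Lemma pullB g g' : pull (g - g') = pull g - pull g'. Proof. exact: PP_ext. Qed.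

Lemma pull_lin_ideal g : g \in lin_ideal (S:=S2) -> pull g \in lin_ideal (S:=S1).
Proof.
move=> /asboolP[e ->]; apply/asboolP.
exists [seq (q *m p.1, pull p.2) | p <- e]; rewrite big_map; apply: PP_ext => x.
rewrite [LHS](pullE _ (y := pull_pt x)) // !PP_sumE; apply: eq_bigr => p _.
by rewrite !PP_mulE /= mulmxA.
Qed.

Lemma pull_class g g' : class g = class g' -> class (pull g) = class (pull g').
Proof. by move=> /classE gg'; apply/classE; rewrite -pullB; exact: pull_lin_ideal. Qed.

End Pullback.

Section Restriction.
Variables (R : realType) (I : finType) (n : nat) (S : fan I n).
Variables (s : {set I}) (m : nat) (q : 'M[int]_(n, m)).
Hypothesis hq : quotient_by R S s q.
Let C := closed_star S s.
Let S' := star S s q.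

Lemma inc_cone : cone_map C S (1%:M : 'M[R]_n).
Proof.
move=> t; rewrite inE => /andP[tS _]; exists t => // x xt.
by rewrite mulmx1.
Qed.

Lemma proj_cone : cone_map C S' (map_mx intr q : 'M[R]_(n, m)).
Proof.
move=> t; rewrite inE => /andP[tS tsS]; exists (t :\: s)%SET.
  apply/imsetP; exists (t :|: s)%SET; first by rewrite inE tsS finset.subsetUr.
  by apply/finset.setP => j; rewrite !inE; case: (j \in s); rewrite ?orbF.
move=> x /coneP[c [c0 ct] ->].
rewrite combo_mul; apply/coneP.
exists (fun j => if j \in s then 0 else c j * (content (ray S j *m q))%:R).
  split=> j; first by case: ifP => // _; rewrite mulr_ge0 ?ler0n.
  by rewrite !inE negb_and negbK; case: (j \in s) => //= /ct ->; rewrite mul0r.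
apply: eq_bigr => j _; case: ifPn => [js|_].
  by rewrite (proj2 (quotient_ker hq _) (ray_span _ _ js)) scaler0 scale0r.
rewrite -scalerA; congr (_ *: _); rewrite /rayR -map_mxM {1}(contentE (ray S j *m q)).
by rewrite map_mxZ.
Qed.

Lemma restriction_class (f : PP R S) (g : PP R S') :
  restriction (class f) (class g) <->
  class (pull inc_cone f) = class (pull proj_cone g).
Proof.
split=> [[f1 [g1 [h [h' [ff gg hf hg hh]]]]]|E].
  rewrite -(pull_class inc_cone ff) -(pull_class proj_cone gg).
  have -> : pull inc_cone f1 = h.
    by apply: PP_ext => x; rewrite (hf _ (pull_pt inc_cone x)) //= mulmx1.
  have -> // : pull proj_cone g1 = h'.
  by apply: PP_ext => x; rewrite (hg _ (pull_pt proj_cone x)).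
exists f, g, (pull inc_cone f), (pull proj_cone g); split=> // x y xy.
  by rewrite (pullE inc_cone _ (y := y)) // mulmx1.
by rewrite (pullE proj_cone _ (y := y)).
Qed.

Lemma restriction_fun (f : PP R S) (g : PP R S') :
  (forall (t : {set I}) (x : supp R S) (y : supp R S'), t \in cones S ->
     (t :|: s)%SET \in cones S -> cone S t (val x) ->
     val x *m map_mx intr q = val y -> f x = g y) ->
  restriction (class f) (class g).
Proof.
move=> fg; apply/restriction_class; congr class; apply: PP_ext => x.
have [t] := suppP x; rewrite inE => /andP[tS tsS] xt.
rewrite [LHS]/= [RHS]/=; apply: (fg t) => //=; rewrite mulmx1 //.
Qed.

Lemma restriction1 : @restriction R I n S s m q 1 1.
Proof. exact: restriction_fun. Qed.

Lemma restrictionD (a a' : chow R S) (b b' : chow R S') :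
  restriction a b -> restriction a' b' -> restriction (a + a') (b + b').
Proof.
rewrite -[a]class_repr -[a']class_repr -[b]class_repr -[b']class_repr.
move=> /restriction_class E /restriction_class E'.
by rewrite -!classD; apply/restriction_class; rewrite !pullD !classD E E'.
Qed.

Lemma restrictionM (a a' : chow R S) (b b' : chow R S') :
  restriction a b -> restriction a' b' -> restriction (a * a') (b * b').
Proof.
rewrite -[a]class_repr -[a']class_repr -[b]class_repr -[b']class_repr.
move=> /restriction_class E /restriction_class E'.
by rewrite -!classM; apply/restriction_class; rewrite !pullM !classM E E'.
Qed.

Lemma restriction_const (c : R) : restriction (class (const S c)) (class (const S' c)).
Proof. exact: restriction_fun. Qed.

Lemma restrictionZ c (a : chow R S) (b : chow R S') :
  restriction a b -> restriction (c *: a) (c *: b).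
Proof. by move=> ab; apply: restrictionM => //; exact: restriction_const. Qed.

Lemma restriction0 : @restriction R I n S s m q 0 0.
Proof. by have := restrictionZ 0 restriction1; rewrite !scale0r. Qed.

Lemma restrictionB (a a' : chow R S) (b b' : chow R S') :
  restriction a b -> restriction a' b' -> restriction (a - a') (b - b').
Proof.
move=> ab ab'; rewrite -scaleN1r -[- b']scaleN1r.
by apply: restrictionD => //; exact: restrictionZ.
Qed.

Lemma restriction_sum (J : Type) (r : seq J) (P : pred J)
    (a : J -> chow R S) (b : J -> chow R S') :
  (forall j, P j -> restriction (a j) (b j)) ->
  restriction (\sum_(j <- r | P j) a j) (\sum_(j <- r | P j) b j).
Proof.
move=> ab; elim/big_rec2: _ => [|j y1 y2 Pj]; first exact: restriction0.
by apply: restrictionD; exact: ab.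
Qed.

Lemma restriction_prod (J : Type) (r : seq J) (P : pred J)
    (a : J -> chow R S) (b : J -> chow R S') :
  (forall j, P j -> restriction (a j) (b j)) ->
  restriction (\prod_(j <- r | P j) a j) (\prod_(j <- r | P j) b j).
Proof.
move=> ab; elim/big_rec2: _ => [|j y1 y2 Pj]; first exact: restriction1.
by apply: restrictionM; exact: ab.
Qed.

End Restriction.

Lemma PP_transport (R : realType) (I : finType) n (S S' : fan I n) (g : PP R S) :
  S' = S -> exists g' : PP R S', [/\ forall x y, val x = val y -> g' x = g y,
    pp_homog 1 g -> pp_homog 1 g' &
    (forall x, val x != 0 -> 0 < g x) -> forall x, val x != 0 -> 0 < g' x].
Proof.
by move=> E; rewrite E; exists g; split=> // x y xy; congr (pp_fun g _); exact: val_inj.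
Qed.

Section RestrictionToRay.
Variables (R : realType) (I : finType) (n : nat) (S : fan I n).
Hypothesis Sf : simplicial_fan R S.
Variables (i : I) (m : nat) (q : 'M[int]_(n, m)).
Hypothesis iS : [set i]%SET \in cones S.
Hypothesis hq : quotient_by R S [set i]%SET q.
Let qR : 'M[R]_(n, m) := map_mx intr q.
Let S' := star S [set i]%SET q.
Let Sf' : simplicial_fan R S' := star_simplicial Sf iS hq.
Let mu j : R := (ray_mult S q j)%:R.

Lemma setUr1 (t : {set I}) : (t :|: [set i] = i |: t)%SET.
Proof. by rewrite finset.setUC. Qed.

Lemma restriction_crt_scale j : j != i ->
  restriction (class (crt Sf j)) ((mu j)^-1 *: class (crt Sf' j) : chow R S').
Proof.
move=> ji; rewrite chow_scaleE -classM; apply: (restriction_fun hq) => t x y tS tiS xt xy.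
rewrite PP_mulE !crtE -xy; rewrite setUr1 in tiS.
rewrite (coord_push Sf iS hq j tiS xt) (negbTE ji) /= mulrCA.
have [jt|jt] := boolP (j \in t); last first.
  by have [[_ ->]] := coordK Sf tS xt; rewrite ?mul0r.
rewrite mulVf ?mulr1 // pnatr_eq0 -lt0n (ray_mult_gt0 Sf hq _ (cones_push _ tiS)) //.
by rewrite !inE ji jt.
Qed.

Lemma restriction_crt_mult j : j != i ->
  restriction (mu j *: class (crt Sf j)) (class (crt Sf' j) : chow R S').
Proof.
move=> ji; rewrite chow_scaleE -classM; apply: (restriction_fun hq) => t x y tS tiS xt xy.
rewrite PP_mulE !crtE -xy; rewrite setUr1 in tiS.
by rewrite (coord_push Sf iS hq j tiS xt) (negbTE ji) /= mulrC.
Qed.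

(* A linear function with value 1 on the ray [i] moves [x_i] off that ray.    *)
Lemma crt_relation : exists c : I -> R,
  class (crt Sf i) = - \sum_(j | j != i) c j *: class (crt Sf j).
Proof.
have [l lE] := dual_functional Sf (fun=> 1 : R) iS.
exists (fun j => (rayR R S j *m l) 0 0).
have lh : pp_homog 1 (lin S l).
  by move=> s _; exists (lin_mpoly l) => [|x _]; rewrite ?lin_mpoly_homog ?peval_lin.
have := homog1_crt Sf (c := fun j => (rayR R S j *m l) 0 0) lh.
have hl j : [set j]%SET \in cones S ->
    forall x : supp R S, val x = rayR R S j -> lin S l x = (rayR R S j *m l) 0 0.
  by move=> _ x /= ->.
move=> /(_ hl) E.
have : class (lin S l) = 0.
  apply/class_eq0/asboolP; exists [:: (l, 1)].
  by rewrite big_seq1 mulr1.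
rewrite E class_sum (bigD1 i) //= lE ?inE // classM -chow_scaleE scale1r.
move/eqP; rewrite addr_eq0 => /eqP ->; congr (- _).
by apply: eq_bigr => j _; rewrite classM -chow_scaleE.
Qed.

Lemma restriction_crt j : exists2 b : chow R S', chow_deg R S' 1 b &
  restriction (class (crt Sf j)) b.
Proof.
have dg k : chow_deg R S' 1 ((mu k)^-1 *: class (crt Sf' k)).
  by apply: chow_degZ; exact: crt_deg.
have [->|ji] := eqVneq j i; last by exists ((mu j)^-1 *: class (crt Sf' j)) => //; exact: restriction_crt_scale.
have [c ->] := crt_relation.
exists (- \sum_(k | k != i) c k *: ((mu k)^-1 *: class (crt Sf' k))).
  by apply/chow_degN/chow_deg_sum => k _; exact: chow_degZ.
rewrite -scaleN1r -[X in restriction _ X]scaleN1r; apply: (restrictionZ hq).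
apply: (restriction_sum hq) => k ki; apply: (restrictionZ hq).
exact: restriction_crt_scale.
Qed.

Lemma restriction_exists k (a : chow R S) : chow_deg R S k a ->
  exists2 b : chow R S', chow_deg R S' k b & restriction a b.
Proof.
elim: k a => [|k IH] a.
  move=> /(chow_deg0_scalar Sf)[c ->]; exists (c *: (1 : chow R S')).
    by apply: chow_degZ; exact: chow_deg1.
  by apply: (restrictionZ hq); exact: (restriction1 hq).
move=> /(chow_gen Sf)[r rd ->].
have /choice[b bP] j : exists b : chow R S', chow_deg R S' k b /\ restriction (r j) b.
  by have [b b1 b2] := IH _ (rd j); exists b.
have /choice[x xP] j : exists x : chow R S', chow_deg R S' 1 x /\ restriction (class (crt Sf j)) x.
  by have [x x1 x2] := restriction_crt j; exists x.
exists (\sum_j x j * b j).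
  by apply: chow_deg_sum => j _; apply: (@chow_degM _ _ _ _ 1); [case: (xP j) | case: (bP j)].
by apply: (restriction_sum hq) => j _; apply: (restrictionM hq); [case: (xP j) | case: (bP j)].
Qed.

Lemma restriction_onto k (b : chow R S') : chow_deg R S' k b ->
  exists2 a : chow R S, chow_deg R S k a & restriction a b.
Proof.
elim: k b => [|k IH] b.
  move=> /(chow_deg0_scalar Sf')[c ->]; exists (c *: (1 : chow R S)).
    by apply: chow_degZ; exact: chow_deg1.
  by apply: (restrictionZ hq); exact: (restriction1 hq).
move=> /(chow_gen Sf')[r rd ->].
have /choice[a aP] j : exists a : chow R S, chow_deg R S k a /\ restriction a (r j).
  by have [a a1 a2] := IH _ (rd j); exists a.
exists (\sum_(j | j != i) mu j *: class (crt Sf j) * a j).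
  apply: chow_deg_sum => j _; apply: (@chow_degM _ _ _ _ 1); last by case: (aP j).
  by apply: chow_degZ; exact: crt_deg.
rewrite [X in restriction _ X](bigD1 i) //= (_ : crt Sf' i = 0) ?class0 ?mul0r ?add0r.
  apply: (restriction_sum hq) => j ji; apply: (restrictionM hq); last by case: (aP j).
  exact: restriction_crt_mult.
by apply: crt_noray; rewrite star_conesP // !inE eqxx.
Qed.

Lemma extend_crt (r : PP R (closed_star S [set i]%SET)) : exists r' : PP R S,
  (forall x y, val x = val y -> r' x = crt Sf i x * r y) /\
  (forall x, ~ supp R (closed_star S [set i]%SET) (val x) -> r' x = 0).
Proof.
set C := closed_star _ _.
pose phi (x : supp R S) : R := crt Sf i x *
  (if pselect (supp R C (val x)) is left h then r (SigSub (mem_set h)) else 0).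
have phiC (x : supp R S) (y : supp R C) : val x = val y -> phi x = crt Sf i x * r y.
  move=> xy; rewrite /phi; case: pselect => [h|[]]; last by rewrite xy; exact: suppP.
  by congr (_ * pp_fun r _); apply: val_inj; rewrite /= xy.
suff phiP : phi \in pp_pred (S:=S).
  exists (MkPP phiP); split=> x; first exact: phiC.
  by move=> nx; rewrite /= /phi; case: pselect => // _; rewrite mulr0.
apply/asboolP => s sS; have [siS|siS] := boolP (s :|: [set i] \in cones S)%SET; last first.
  exists 0 => x xs; have [[_ cs] _] := coordK Sf sS xs.
  rewrite /phi crtE cs ?mul0r /peval ?meval0 //; apply: contraNN siS => si.
  by rewrite setUr1 (finset.setUidPr _) // finset.sub1set.
have sC : s \in cones C by rewrite inE sS.
have [p pE] : exists p, forall y : supp R C, cone C s (val y) -> r y = peval p (val y).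
  by case: (r) => r0 /= /asboolP/(_ s sC).
have [l lE] := coord_lin Sf sS; exists (lin_mpoly (l i) * p) => x xs.
have xC : supp R C (val x) by exists s.
rewrite (phiC x (SigSub (mem_set xC))) // crtE lE // pE //.
by rewrite /peval mevalM -!/(peval _ _) peval_lin.
Qed.

Lemma restriction_zero (a : chow R S) : restriction a (0 : chow R S') ->
  class (crt Sf i) * a = 0.
Proof.
rewrite -[a]class_repr -class0; set f := repr a => /(restriction_class hq).
set C := closed_star S [set i]%SET; set inc := @inc_cone R I n S [set i]%SET.
move=> E; have {E} : pull inc f \in lin_ideal (S:=C).
  apply/class_eq0; rewrite E; apply/class_eq0; apply: pull_lin_ideal.
  by apply/class_eq0; exact: class0.
move=> /asboolP[e fE]; rewrite -classM; apply/class_eq0/asboolP.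
have /choice[ext extP] := extend_crt.
exists [seq (p.1, ext p.2) | p <- e]; rewrite big_map; apply: PP_ext => x.
rewrite PP_mulE PP_sumE.
have [xC|xC] := pselect (supp R C (val x)); last first.
  rewrite big1 => [|p _]; last by rewrite PP_mulE (proj2 (extP _)) ?mulr0.
  suff -> : crt Sf i x = 0 by rewrite mul0r.
  have [s sS xs] := suppP x; have [[_ cs] _] := coordK Sf sS xs.
  rewrite crtE cs //; apply/negP => si; apply: xC; exists s => //.
  by rewrite inE sS setUr1 (finset.setUidPr _) // finset.sub1set.
pose y : supp R C := SigSub (mem_set xC).
have : pull inc f y = f x by apply: pullE; rewrite mulmx1.
move=> <-; rewrite fE PP_sumE mulr_sumr; apply: eq_bigr => p _.
by rewrite !PP_mulE (proj1 (extP _) x y erefl) mulrCA.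
Qed.

Lemma star_star (t : {set I}) m' (q' : 'M[int]_(m, m')) : t \in cones S' ->
  star S' t q' = star S (i |: t)%SET (q *m q').
Proof.
move=> tS; rewrite /star /=; congr Fan.
  apply: funext => j; have [jq|jq] := eqVneq (ray S j *m q) 0.
    rewrite mulmxA jq mul0mx (_ : primitive_part 0 = 0) ?mul0mx //.
    by apply/rowP => k; rewrite !mxE div0z.
  rewrite mulmxA {2}(contentE (ray S j *m q)) -scalemxAl primitive_partZ //.
  by rewrite lt0n; apply: contraNneq jq => /content_eq0 ->.
have it : i \notin t by move: tS; rewrite star_conesP // => /andP[].
apply/finset.setP => u; apply/imsetP/imsetP => [[v]|[v]].
  rewrite inE => /andP[/imsetP[w]]; rewrite inE finset.sub1set => /andP[wS iw] -> tw ->.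
  exists w; last by rewrite finset.setDDl.
  rewrite inE wS finset.subUset finset.sub1set iw /=.
  by apply: (fintype.subset_trans tw); exact: finset.subsetDl.
rewrite inE finset.subUset finset.sub1set => /andP[vS /andP[iv tv]] ->.
exists (v :\ i)%SET; last by rewrite finset.setDDl.
rewrite inE; apply/andP; split.
  by apply/imsetP; exists v => //; rewrite inE vS finset.sub1set.
by rewrite finset.subsetD1 tv.
Qed.

Lemma quotient_comp (t : {set I}) m' (q' : 'M[int]_(m, m')) : t \in cones S' ->
  quotient_by R S' t q' -> quotient_by R S (i |: t)%SET (q *m q').
Proof.
move=> tS [qsurj qker]; split=> [w|v].
  have [v' v'E] := qsurj w; have [v vE] := (proj1 hq) v'.
  by exists v; rewrite mulmxA vE.
have it : i \notin t by move: tS; rewrite star_conesP // => /andP[].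
rewrite mulmxA; split=> [/qker/cone_spanP[c vE]|/cone_spanP[c vE]].
  pose w := \sum_(j in t) (c j / mu j) *: rayR R S j.
  have wq : w *m qR = \sum_(j in t) c j *: rayR R S' j.
    rewrite mulmx_suml; apply: eq_bigr => j jt.
    rewrite -scalemxAl (rayR_star R S i) scalerA divfK // pnatr_eq0 -lt0n.
    exact: (ray_mult_gt0 Sf hq jt tS).
  have [a aE] : exists a, map_mx intr v - w = a *: rayR R S i.
    by apply: (ker_ray hq); rewrite mulmxBl wq -vE map_mxM subrr.
  apply/cone_spanP; exists (fun j => if j == i then a else c j / mu j).
  rewrite finset.big_setU1 //= eqxx -aE [RHS]addrC -[LHS](subrK w) addrC; congr (_ + _).
  by apply: eq_bigr => j jt; case: eqP => // ji; rewrite -ji jt in it.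
apply/qker/cone_spanP; exists (fun j => c j * mu j).
rewrite map_mxM vE mulmx_suml finset.big_setU1 //= -scalemxAl (rayR_star_i hq) scaler0 add0r.
by apply: eq_bigr => j _; rewrite -scalemxAl (rayR_star R S i) scalerA.
Qed.

Lemma ample_star (l : chow R S) : ample l ->
  exists2 b : chow R S', restriction l b & ample b.
Proof.
move=> [ldeg lP]; have [g lg [gh gpos]] := lP _ iS m q hq.
exists (class g) => //; split=> [|t tS m' q' hq']; first by exists g.
have tS' : (i |: t)%SET \in cones S by move: tS; rewrite star_conesP // => /andP[].
have hqq := quotient_comp tS hq'.
have [g2 lg2 [g2h g2pos]] := lP _ tS' m' (q *m q') hqq.
have [g3 [g3E g3h g3pos]] := PP_transport g2 (star_star q' tS).
exists g3; last by split; [exact: g3h | exact: g3pos].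
move: lg lg2; rewrite -[l]class_repr; set f := repr l.
move=> /(restriction_class hq) E1 /(restriction_class hqq) E2.
apply/(restriction_class hq').
set C := closed_star S [set i]%SET in E1; set C2 := closed_star S (i |: t)%SET in E2.
set inc1 := @inc_cone _ _ _ _ _ in E1; set pr1 := @proj_cone _ _ _ _ _ _ _ _ in E1.
set inc2 := @inc_cone _ _ _ _ _ in E2; set pr2 := @proj_cone _ _ _ _ _ _ _ _ in E2.
set inc3 := @inc_cone _ _ _ _ _; set pr3 := @proj_cone _ _ _ _ _ _ _ _.
have r : cone_map C2 C (1%:M : 'M[R]_n).
  move=> u; rewrite inE => /andP[uS uitS]; exists u => [|x]; last by rewrite mulmx1.
  rewrite inE uS; apply: (cones_sub Sf uitS).
  by apply: finset.setUS; rewrite finset.sub1set !inE eqxx.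
pose E := pull r (pull pr1 g) - pull pr2 g2.
have EI : E \in lin_ideal (S:=C2).
  apply/classE; rewrite -E2 -(pull_class r E1); congr class.
  by apply: PP_ext => x; rewrite /=; congr (pp_fun f _); apply: val_inj; rewrite /= !mulmx1.
have Eh : pp_homog 1 E.
  by apply: pp_homogD; [|apply: pp_homogN]; do !apply: pull_homog.
have [L EL] := lin_ideal_homog1 EI Eh.
have EE x (y : supp R S') (z : supp R (star S' t q')) :
    val x *m qR = val y -> val y *m map_mx intr q' = val z -> E x = g y - g3 z.
  move=> xy yz; rewrite /E PP_addE PP_oppE.
  rewrite (pullE r _ (y := pull_pt r x)) // (pullE pr1 g (y := y)); last by rewrite /= mulmx1.
  have zS : supp R (star S (i |: t)%SET (q *m q')) (val z).
    by rewrite -(star_star q' tS); exact: suppP.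
  rewrite (pullE pr2 g2 (y := SigSub (mem_set zS))); last first.
    by rewrite /= map_mxM mulmxA xy.
  by rewrite (g3E z (SigSub (mem_set zS))).
have Lray j : j \in [set i]%SET -> (rayR R S j *m L) 0 0 = 0.
  rewrite inE => /eqP ->.
  have iC2 : supp R C2 (rayR R S i).
    exists [set i]%SET; last by exists (fun=> 1) => //; rewrite finset.big_set1 scale1r.
    rewrite inE iS (finset.setUidPr _) // finset.sub1set !inE eqxx //.
  pose x : supp R C2 := SigSub (mem_set iC2).
  have -> : (rayR R S i *m L) 0 0 = E x by rewrite EL.
  have yz : val (pull_pt pr1 (pull_pt r x)) = 0.
    by rewrite /= mulmx1; exact: (rayR_star_i hq).
  rewrite /E PP_addE PP_oppE.
  rewrite (pullE r _ (y := pull_pt r x)) // (pullE pr1 g (y := pull_pt pr1 (pull_pt r x))) //.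
  rewrite (homog_at0 gh yz) (pullE pr2 g2 (y := pull_pt pr2 x)) //.
  rewrite (homog_at0 g2h) ?subrr //= map_mxM mulmxA.
  by rewrite (rayR_star_i hq) mul0mx.
have [L' L'E] := quotient_lift hq Lray.
apply/classE/asboolP; exists [:: (L', 1)]; rewrite big_seq1 mulr1; apply: PP_ext => y.
have [u] := suppP y; rewrite inE => /andP[uS utS] yu.
have [x xu xy] := cone_lift Sf hq uS yu.
have xC2 : supp R C2 x.
  exists u => //; rewrite inE (star_cones_sub Sf uS) /=.
  rewrite finset.setUCA; move: utS; rewrite star_conesP // => /andP[_].
  by [].
transitivity (E (SigSub (mem_set xC2))); last by rewrite EL /= -L'E mulmxA xy.
by apply/esym/(EE _ (pull_pt inc3 y) (pull_pt pr3 y)); rewrite /= mulmx1.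
Qed.

End RestrictionToRay.

Lemma lefschetzP (R : realType) (I : finType) n (S : fan I n) d : lefschetz R S d ->
  exists (w : {set I} -> R) (deg : {scalar chow R S}),
    [/\ Defs.dim S = d, fundamental_weight S d w & degree_map d w deg] /\
    [/\ set_bij (chow_deg R S d) [set: R] deg, poincare_duality d deg,
        hodge_riemann d deg &
        (forall s : {set I}, s \in cones S -> (0 < #|s|)%N ->
           forall m (q : 'M[int]_(n, m)), quotient_by R S s q ->
           lefschetz R (star S s q) (d - #|s|))].
Proof. by case=> {}n {}S {}d w deg *; exists w, deg. Qed.

(** * Chow groups and degree maps *)

Section ChowGroups.
Variables (R : realType) (I : finType) (n : nat) (S : fan I n).
Hypothesis Sf : simplicial_fan R S.

Lemma cone_dim (s : {set I}) : s \in cones S -> (#|s| <= Defs.dim S)%N.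
Proof. by move=> sS; rewrite /Defs.dim (bigD1 s) //= leq_maxl. Qed.

Lemma top_cone : exists2 s : {set I}, s \in cones S & #|s| = Defs.dim S.
Proof.
have [|s sS sE] := @eq_bigmax_cond _ (mem (cones S)) (fun s : {set I} => #|s|).
  by apply/card_gt0P; exists finset.set0; exact: (cones0 Sf).
by exists s.
Qed.

Definition comb N (e : 'I_N -> chow R S) (x : 'rV[R]_N) : chow R S :=
  \sum_j x 0 j *: e j.

Definition spans k N (e : 'I_N -> chow R S) : Prop :=
  (forall j, chow_deg R S k (e j)) /\
  forall a, chow_deg R S k a -> exists x, a = comb e x.

Lemma chow_finite k : exists N (e : 'I_N -> chow R S), spans k e.
Proof.
suff [T [e [ed espan]]] : exists (T : finType) (e : T -> chow R S),
    (forall j, chow_deg R S k (e j)) /\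
    forall a, chow_deg R S k a -> exists x : T -> R, a = \sum_j x j *: e j.
  exists #|T|, (e \o enum_val); split=> [j|a /espan[x ->]]; first exact: ed.
  exists (\row_j x (enum_val j)); rewrite /comb (reindex_onto enum_val enum_rank) /=.
    by apply: eq_big => [j|j _]; rewrite ?enum_valK ?eqxx // mxE.
  by move=> j _; rewrite enum_rankK.
elim: k => [|k [T [e [ed espan]]]].
  exists unit, (fun=> 1); split=> [_|a /(chow_deg0_scalar Sf)[c ->]]; first exact: chow_deg1.
  by exists (fun=> c); rewrite (bigD1 tt) //= big1 ?addr0 // => -[].
exists (I * T)%type, (fun p => class (crt Sf p.1) * e p.2); split.
  by move=> p; apply: (@chow_degM _ _ _ _ 1) => //; exact: crt_deg.
move=> a /(chow_gen Sf)[r rd ->].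
have /choice[x xE] j := espan _ (rd j).
exists (fun p => x p.1 p.2); rewrite -(pair_bigA _ (fun i j => x i j *: (class (crt Sf i) * e j))) /=.
apply: eq_bigr => i _; rewrite xE mulr_sumr; apply: eq_bigr => j _.
by rewrite chow_scaleAr.
Qed.

Lemma chow_basis k : exists N (e : 'I_N -> chow R S),
  spans k e /\ forall x, comb e x = 0 -> x = 0.
Proof.
have ex : exists N, `[< exists e : 'I_N -> chow R S, spans k e >].
  by have [N [e he]] := chow_finite k; exists N; apply/asboolP; exists e.
have [N /asboolP[e [ed espan]] Nmin] := ex_minnP ex.
exists N, e; split=> // x x0; apply/rowP => j; rewrite [RHS]mxE; apply/eqP.
apply: contraT => xj; case: N e ed espan Nmin x x0 j xj => [|N] e ed espan Nmin x x0 j xj; first by case: j {xj}.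
suff : (N.+1 <= N)%N by rewrite ltnn.
apply: Nmin; apply/asboolP; exists (e \o lift j); split=> [k'|a /espan[y ->]]; first exact: ed.
exists (\row_k' (y 0 (lift j k') - y 0 j / x 0 j * x 0 (lift j k'))).
have -> : comb e y = comb e y - (y 0 j / x 0 j) *: comb e x by rewrite x0 scaler0 subr0.
rewrite /comb scaler_sumr -sumrB (bigD1_ord j) //= scalerA divfK // subrr add0r.
by apply: eq_bigr => k' _; rewrite mxE scalerA scalerBl.
Qed.

Lemma comb_deg k N (e : 'I_N -> chow R S) x : (forall j, chow_deg R S k (e j)) ->
  chow_deg R S k (comb e x).
Proof. by move=> ed; apply: chow_deg_sum => j _; exact: chow_degZ. Qed.

Lemma comb_mul N (e : 'I_N -> chow R S) r (y : 'rV[R]_r) (W : 'M[R]_(r, N)) :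
  comb e (y *m W) = comb (fun j => comb e (row j W)) y.
Proof.
rewrite /comb; under [RHS]eq_bigr do rewrite scaler_sumr.
rewrite exchange_big; apply: eq_bigr => j _; rewrite mxE scaler_suml.
by apply: eq_bigr => k _; rewrite scalerA mxE.
Qed.

Lemma mul_comb (a : chow R S) N (e : 'I_N -> chow R S) x :
  a * comb e x = comb (fun j => a * e j) x.
Proof. by rewrite /comb mulr_sumr; apply: eq_bigr => j _; rewrite chow_scaleAr. Qed.

Lemma chow_degE k l (a : chow R S) : chow_deg R S k a -> k = l -> chow_deg R S l a.
Proof. by move=> h <-. Qed.

Lemma chow_deg_nat_prod (F : nat -> chow R S) a N :
  (forall j, (a <= j < a + N)%N -> chow_deg R S 1 (F j)) ->
  chow_deg R S N (\prod_(a <= j < a + N) F j).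
Proof.
elim: N => [|N IH] FP; first by rewrite addn0 big_geq //; exact: chow_deg1.
rewrite addnS big_nat_recr ?leq_addr //= -addn1; apply: chow_degM.
  by apply: IH => j /andP[aj jN]; apply: FP; rewrite aj addnS ltnW.
by apply: FP; rewrite leq_addr addnS ltnSn.
Qed.

Lemma chow_deg_set_prod (s : {set I}) (F : I -> chow R S) :
  (forall j, chow_deg R S 1 (F j)) -> chow_deg R S #|s| (\prod_(j in s) F j).
Proof. by move=> FP; rewrite -big_enum cardE; exact: chow_deg_prod. Qed.

Lemma degree_pos d w (deg : {scalar chow R S}) (s : {set I}) :
  fundamental_weight S d w -> degree_map d w deg ->
  s \in cones S -> #|s| = d -> 0 < deg (\prod_(j in s) class (crt Sf j)).
Proof.
move=> [_ wpos _] degw sS sd; have [m m0 hm] := multiplicity_exists R S s.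
have := wpos s sS sd; rewrite -(degw s m (crt Sf) sS sd hm).
  by rewrite pmulr_rgt0 // ltr0n.
by move=> i _; exact: crt_courant.
Qed.

Lemma line_scalar d (deg : {scalar chow R S}) a0 a :
  set_bij (chow_deg R S d) [set: R] deg -> deg a0 != 0 ->
  chow_deg R S d a0 -> chow_deg R S d a -> a = (deg a / deg a0) *: a0.
Proof.
move=> [_ inj _] n0 d0 da; apply: inj; rewrite ?inE //; first exact: chow_degZ.
by rewrite linearZ /= divfK.
Qed.

Lemma degree_ratio d w w' (deg deg' : {scalar chow R S}) : Defs.dim S = d ->
  fundamental_weight S d w -> degree_map d w deg ->
  set_bij (chow_deg R S d) [set: R] deg ->
  fundamental_weight S d w' -> degree_map d w' deg' ->
  exists2 c, 0 < c & forall a, chow_deg R S d a -> deg' a = c * deg a.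
Proof.
move=> dimS hw hdeg bij hw' hdeg'; have [s sS sd] := top_cone; rewrite dimS in sd.
have p := degree_pos hw hdeg sS sd; have p' := degree_pos hw' hdeg' sS sd.
set a0 := \prod_(j in s) _ in p p'; exists (deg' a0 / deg a0); first exact: divr_gt0.
have a0d : chow_deg R S d a0 by rewrite -sd; apply: chow_deg_set_prod => j; exact: crt_deg.
move=> a ad; rewrite [in LHS](line_scalar bij (lt0r_neq0 p) a0d ad) linearZ /=.
by rewrite mulrC mulrA mulrAC.
Qed.

Lemma ample_positive (l : chow R S) : ample l -> exists2 c : I -> R,
  (forall i, [set i]%SET \in cones S -> 0 < c i) & l = \sum_i c i *: class (crt Sf i).
Proof.
move=> [_ lP]; have hq : quotient_by R S finset.set0 (1%:M : 'M[int]_n).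
  split=> [w|v]; first by exists w; rewrite mulmx1.
  rewrite mulmx1 /cone_span finset.big_set0 submx0; split=> [->|/eqP v0].
    by rewrite map_mx0.
  apply/rowP => j; rewrite [RHS]mxE; have := congr1 (fun u : 'rV[R]_n => u 0 j) v0.
  by rewrite !mxE => /eqP; rewrite intr_eq0 => /eqP.
have [g lg [gh gpos]] := lP _ (cones0 Sf) n 1%:M hq.
move: lg; rewrite -[l]class_repr; set f := repr l => /(restriction_class hq).
set inc := @inc_cone _ _ _ _ _; set pr := @proj_cone _ _ _ _ _ _ _ _ => E.
have r : cone_map S (closed_star S finset.set0) (1%:M : 'M[R]_n).
  move=> s sS; exists s => [|x]; last by rewrite mulmx1.
  by rewrite inE finset.setU0 sS.
pose phi := pull r (pull pr g).
have -> : class f = class phi.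
  rewrite -(pull_class r E); congr class; apply: PP_ext => x.
  by rewrite /=; congr (pp_fun f _); apply: val_inj; rewrite /= !mulmx1.
have phih : pp_homog 1 phi by do !apply: pull_homog.
have /choice[c cP] i : exists c, [set i]%SET \in cones S ->
    0 < c /\ forall x : supp R S, val x = rayR R S i -> phi x = c.
  have [iS|] := boolP ([set i]%SET \in cones S); last by exists 0.
  pose x : supp R S := SigSub (mem_set (supp_ray R iS)).
  exists (phi x) => _; split=> [|y yx]; last by congr (pp_fun phi _); exact: val_inj.
  apply: gpos; rewrite /= mulmx1 map_mx1 mulmx1; apply/eqP => r0.
  have : content (ray S i) = 1%N by case: Sf => _ _ + _ _; apply.
  rewrite /content big1 // => j _; apply/eqP; rewrite absz_eq0 -(intr_eq0 R).
  by have := congr1 (fun u : 'rV[R]_n => u 0 j) r0; rewrite !mxE => ->.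
exists c => [i /cP[]//|].
have phiE := homog1_crt Sf phih (c := c) (fun i iS => proj2 (cP i iS)).
by rewrite phiE class_sum; apply: eq_bigr => i _; rewrite classM.
Qed.

Lemma ample_convex (l l' : chow R S) t : 0 <= t <= 1 -> ample l -> ample l' ->
  ample ((1 - t) *: l + t *: l').
Proof.
move=> /andP[t0 t1] [ld lP] [ld' lP']; split.
  by apply: chow_degD; exact: chow_degZ.
move=> s sS m q hq; have [g lg [gh gpos]] := lP s sS m q hq.
have [g' lg' [gh' gpos']] := lP' s sS m q hq.
exists (const _ (1 - t) * g + const _ t * g').
  by rewrite classD !classM; apply: (restrictionD hq); exact: (restrictionZ hq).
split=> [|x x0]; first by apply: pp_homogD; exact: pp_homogZ.
rewrite PP_addE !PP_mulE /=; have [->|tn0] := eqVneq t 0.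
  by rewrite mul0r addr0 subr0 mul1r gpos.
by rewrite ltr_wpDl ?mulr_gt0 ?gpos' ?lt0r ?tn0 // mulr_ge0 ?subr_ge0 // ltW ?gpos.
Qed.

End ChowGroups.

Lemma chow_deg_above (R : realType) (I : finType) d n (S : fan I n) a :
  simplicial_fan R S -> (Defs.dim S <= d)%N -> chow_deg R S d.+1 a -> a = 0.
Proof.
elim: d n S a => [|d IH] n S a Sf dimS /(chow_gen Sf)[r rd ->]; rewrite big1 // => i _.
all: have [iS|iS] := boolP ([set i]%SET \in cones S); last by rewrite crt_noray // class0 mul0r.
  by have := leq_trans (cone_dim iS) dimS; rewrite cards1.
have [m [q hq]] := quotient_exists Sf iS.
have [b bd rb] := restriction_exists Sf iS hq (rd i).
apply: (restriction_zero Sf hq); rewrite -(IH _ _ b (star_simplicial Sf iS hq)) //.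
apply/bigmax_leqP => t; rewrite star_conesP => /andP[it /cone_dim].
by rewrite cardsU1 it => /leq_trans/(_ dimS).
Qed.

Section RayDegree.
Variables (R : realType) (I : finType) (n : nat) (S : fan I n).
Hypothesis Sf : simplicial_fan R S.
Variables (i : I) (m : nat) (q : 'M[int]_(n, m)).
Hypothesis iS : [set i]%SET \in cones S.
Hypothesis hq : quotient_by R S [set i]%SET q.
Let S' := star S [set i]%SET q.
Let Sf' : simplicial_fan R S' := star_simplicial Sf iS hq.
Variables (d : nat) (w w' : {set I} -> R).
Variables (deg : {scalar chow R S}) (deg' : {scalar chow R S'}).
Hypotheses (hw : fundamental_weight S d.+1 w) (hdeg : degree_map d.+1 w deg).
Hypotheses (dimS' : Defs.dim S' = d).
Hypotheses (hw' : fundamental_weight S' d w') (hdeg' : degree_map d w' deg').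
Hypothesis bij' : set_bij (chow_deg R S' d) [set: R] deg'.

Lemma ray_degree : exists2 c, 0 < c & forall (a : chow R S) (b : chow R S'),
  chow_deg R S' d b -> restriction a b -> deg (class (crt Sf i) * a) = c * deg' b.
Proof.
have [t tS td] := top_cone Sf'; rewrite dimS' in td.
have [it tiS] : i \notin t /\ (i |: t)%SET \in cones S.
  by move: tS; rewrite star_conesP => /andP[].
have sd : #|(i |: t)%SET| = d.+1 by rewrite cardsU1 it td.
pose mu j : R := (ray_mult S q j)%:R.
pose a0 := \prod_(j in t) class (crt Sf j).
pose b0 := \prod_(j in t) ((mu j)^-1 *: class (crt Sf' j)) : chow R S'.
have ab0 : restriction a0 b0.
  apply: (restriction_prod hq) => j jt; apply: restriction_crt_scale.
  by apply: contraNneq it => <-.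
have b0d : chow_deg R S' d b0.
  by rewrite -td; apply: chow_deg_set_prod => // j; apply: chow_degZ; exact: crt_deg.
have b0E : b0 = (\prod_(j in t) (mu j)^-1) *: \prod_(j in t) class (crt Sf' j).
  rewrite /b0; elim/big_rec3: _ => [|j x y z _ ->]; first by rewrite scale1r.
  by rewrite chow_scaleAl chow_scaleAr scalerA.
have b0pos : 0 < deg' b0.
  rewrite b0E linearZ /= mulr_gt0 ?(degree_pos Sf' hw' hdeg') //.
  apply: prodr_gt0 => j jt; rewrite invr_gt0 ltr0n.
  exact: (ray_mult_gt0 Sf hq jt tS).
have a0pos : 0 < deg (class (crt Sf i) * a0).
  have := degree_pos Sf hw hdeg tiS sd.
  by rewrite finset.big_setU1.
exists (deg (class (crt Sf i) * a0) / deg' b0); first exact: divr_gt0.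
move=> a b bd ab; pose s := deg' b / deg' b0.
have : class (crt Sf i) * (a - s *: a0) = 0.
  apply: (restriction_zero Sf hq).
  rewrite -(subrr b) {2}(line_scalar bij' (lt0r_neq0 b0pos) b0d bd) -/s.
  by apply: (restrictionB hq) => //; exact: (restrictionZ hq).
move/(congr1 deg); rewrite mulrBr chow_scaleAr linearB linearZ /= linear0.
by move/eqP; rewrite subr_eq0 => /eqP ->; rewrite /s mulrC mulrAC mulrA.
Qed.

Hypothesis pd' : poincare_duality d deg'.

Lemma restriction_of_0 j (b : chow R S') : (j <= d.+1)%N -> chow_deg R S' j b ->
  restriction (0 : chow R S) b -> b = 0.
Proof.
rewrite leq_eqVlt => /orP[/eqP ->|]; first by move=> bd _; exact: (chow_deg_above Sf' (eq_leq dimS') bd).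
rewrite ltnS => jd bd rb; apply: (proj1 (pd' jd)) => // y yd.
have [a ad ay] := restriction_onto Sf iS hq yd.
have [c c0 cE] := ray_degree.
have := cE 0 (b * y); rewrite mulr0 linear0 => /(_ _ _)/esym/eqP.
have byd : chow_deg R S' d (b * y) by rewrite -(subnKC jd); exact: chow_degM.
have rby : restriction (0 : chow R S) (b * y) by rewrite -(mul0r a); exact: (restrictionM hq).
by move=> /(_ byd rby); rewrite mulf_eq0 gt_eqF //= => /eqP.
Qed.

End RayDegree.

(** * Mixed hard Lefschetz and Hodge-Riemann *)

Section Mixed.
Variables (R : realType) (I : finType) (n : nat) (S : fan I n).
Hypothesis Sf : simplicial_fan R S.
Variables (d : nat) (w : {set I} -> R) (deg : {scalar chow R S}).
Hypotheses (dimS : Defs.dim S = d).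
Hypotheses (hw : fundamental_weight S d w) (hdeg : degree_map d w deg).
Hypothesis pd : poincare_duality d deg.

Definition stars_mixed : Prop := forall i, [set i]%SET \in cones S ->
  forall m (q : 'M[int]_(n, m)), quotient_by R S [set i]%SET q ->
  exists (w' : {set I} -> R) (deg' : {scalar chow R (star S [set i]%SET q)}),
  [/\ Defs.dim (star S [set i]%SET q) = d.-1,
      fundamental_weight (star S [set i]%SET q) d.-1 w' & degree_map d.-1 w' deg'] /\
  [/\ set_bij (chow_deg R (star S [set i]%SET q) d.-1) [set: R] deg',
      poincare_duality d.-1 deg' & mixed_hodge_riemann d.-1 deg'].

(* Apply the Hodge-Riemann relations of the stars of the rays to the          *)
(* restrictions of [a], and write [l 1 = \sum_i c i * x_i] with [c i > 0].    *)
Lemma mixed_lefschetz_inj k (l : nat -> chow R S) (a : chow R S) : stars_mixed ->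
  (k.*2 < d)%N -> (forall j, (1 <= j <= d - k.*2)%N -> ample (l j)) ->
  chow_deg R S k a -> (\prod_(1 <= j < (d - k.*2).+1) l j) * a = 0 -> a = 0.
Proof.
rewrite /stars_mixed; case: d hw hdeg pd dimS => // d' hw1 hdeg1 pd1 dim1 /= hstar kd.
pose M := (d' - k.*2)%N; have dM : (d'.+1 - k.*2 = M.+1)%N by rewrite subSn.
rewrite dM => lamp ad; rewrite big_ltn // big_add1 /=.
set P := \prod_(1 <= j < M.+1) _ => La.
suff xa : forall i, class (crt Sf i) * a = 0.
  have kd1 : (k <= d'.+1)%N by apply: leq_trans (ltnW kd); rewrite -addnn leq_addr.
  apply: (proj1 (pd1 k kd1)) => // b; rewrite subSn; last by rewrite -ltnS (leq_trans _ kd) // ltnS -addnn leq_addr.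
  move=> /(chow_gen Sf)[r rd ->]; rewrite mulr_sumr big1 ?linear0 // => j _.
  by rewrite mulrA [a * _]mulrC xa mul0r.
have [c cpos lE] := ample_positive Sf (lamp 1%N isT).
pose Q i := (-1) ^+ k * deg (class (crt Sf i) * (P * a * a)).
have QP i : 0 <= c i * Q i /\ (c i * Q i = 0 -> class (crt Sf i) * a = 0).
  have [iS|iS] := boolP ([set i]%SET \in cones S); last first.
    by rewrite /Q crt_noray // class0 !mul0r linear0 !mulr0.
  have [m [q hq]] := quotient_exists Sf iS.
  have [w' [deg' [[dim' hw' hdeg'] [bij' pd' hr']]]] := hstar i iS m q hq.
  have [e e0 eE] := ray_degree Sf iS hq hw1 hdeg1 dim' hw' hdeg' bij'.
  have [b bd ab] := restriction_exists Sf iS hq ad.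
  have /choice[y yP] j : exists y : chow R (star S [set i]%SET q), (j <= M)%N ->
      restriction (l j.+1) y /\ ample y.
    have [jM|] := leqP j M; last by exists 0.
    by have [y y1 y2] := ample_star Sf iS hq (lamp j.+1 jM); exists y.
  have yd j : (j <= M)%N -> chow_deg R (star S [set i]%SET q) 1 (y j).
    by move=> /yP[_ []].
  pose P' := \prod_(1 <= j < M.+1) y j.
  have PP' : restriction P P'.
    rewrite /P /P' big_nat_cond [\prod_(1 <= j < M.+1) y j]big_nat_cond.
    by apply: (restriction_prod hq) => j /andP[/andP[_ jM] _]; case: (yP j jM).
  have P'd : chow_deg R (star S [set i]%SET q) M P'.
    by apply: (@chow_deg_nat_prod _ _ _ _ y 1 M) => j /andP[_ jM]; exact: yd.
  have QE : Q i = e * ((-1) ^+ k * deg' (P' * b * b)).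
    rewrite /Q (eE _ (P' * b * b)); first by rewrite mulrCA.
      apply: chow_degE (chow_degM (chow_degM P'd bd) bd) _.
      by rewrite -addnA addnn subnK.
    by do !apply: (restrictionM hq).
  have Pb0 : (\prod_(0 <= j < M.+1) y j) * b = 0.
    rewrite big_ltn // -/P' -mulrA.
    apply: (restriction_of_0 Sf iS hq hw1 hdeg1 dim' hw' hdeg' bij' pd' (j := (1 + (M + k))%N)).
    - by rewrite add1n ltnS /M -addnn subnDA subnK ?leq_subr // leq_subRL -?addnn //; move: kd; rewrite ltnS -addnn; lia.
    - by apply: chow_degM; [exact: yd | exact: chow_degM].
    - rewrite -La -mulrA; apply: (restrictionM hq); first by case: (yP 0%N isT).
      exact: (restrictionM hq).
  have [b0|b0] := eqVneq b 0.
    rewrite QE b0 mulr0 linear0 !mulr0; split=> // _.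
    by apply: (restriction_zero Sf hq); rewrite -b0.
  have := hr' k kd y (fun j jM => proj2 (yP j jM)) b bd Pb0 b0.
  rewrite -/M -/P' => pos.
  have cQ : 0 < c i * Q i by rewrite mulr_gt0 ?cpos // QE mulr_gt0.
  by split=> [|cQ0]; [exact: ltW | move: cQ; rewrite cQ0 ltxx].
have sumQ : \sum_i c i * Q i = 0.
  have -> : \sum_i c i * Q i = (-1) ^+ k * deg (l 1%N * P * a * a).
    rewrite lE -!mulrA mulr_suml linear_sum mulr_sumr; apply: eq_bigr => i _.
    by rewrite /Q chow_scaleAl linearZ /= mulrCA !mulrA.
  by rewrite La mul0r linear0 mulr0.
move=> i; apply: (proj2 (QP i)).
by apply: (psumr_eq0P (fun j _ => proj1 (QP j)) sumQ).
Qed.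

Definition gram N (e : 'I_N -> chow R S) (B : chow R S) : 'M[R]_N :=
  \matrix_(i, j) deg (B * e i * e j).

Lemma gram_mul_basis N (e : 'I_N -> chow R S) B x j :
  (x *m gram e B) 0 j = deg (B * comb e x * e j).
Proof.
rewrite mxE mulr_sumr mulr_suml linear_sum; apply: eq_bigr => i _.
by rewrite chow_scaleAr chow_scaleAl linearZ /= !mxE.
Qed.

Lemma form_gram N (e : 'I_N -> chow R S) B x y :
  form_at (gram e B) x y = deg (B * comb e x * comb e y).
Proof.
rewrite /form_at mxE mul_comb {2}/comb linear_sum; apply: eq_bigr => j _.
by rewrite linearZ /= gram_mul_basis mulrC mxE.
Qed.

Lemma gram_unit k N (e : 'I_N -> chow R S) B : (k.*2 <= d)%N ->
  spans k e -> (forall x, comb e x = 0 -> x = 0) -> chow_deg R S (d - k.*2) B ->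
  (forall a, chow_deg R S k a -> B * a = 0 -> a = 0) -> gram e B \in unitmx.
Proof.
move=> kd [ed espan] efree Bd Binj; apply: kermx0_unitmx => x x0; apply: efree.
have xd : chow_deg R S k (comb e x) by exact: comb_deg.
apply: Binj => //; have kd' : (k <= d)%N by apply: leq_trans kd; rewrite -addnn leq_addr.
apply: (proj2 (pd kd')) => [|a /espan[y ->]].
  by apply: chow_degE (chow_degM Bd xd) _; move: kd; rewrite -addnn; lia.
by rewrite mulrC -form_gram /form_at x0 mul0mx mxE.
Qed.

Lemma lefschetz_bij k B : (k.*2 <= d)%N -> chow_deg R S (d - k.*2) B ->
  (forall a, chow_deg R S k a -> B * a = 0 -> a = 0) ->
  set_bij (chow_deg R S k) (chow_deg R S (d - k)) (fun a => B * a).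
Proof.
move=> kd Bd Binj; have kd' : (k <= d)%N by apply: leq_trans kd; rewrite -addnn leq_addr.
have Bk a : chow_deg R S k a -> chow_deg R S (d - k) (B * a).
  by move=> ad; apply: chow_degE (chow_degM Bd ad) _; move: kd; rewrite -addnn; lia.
split=> [a|a a'|b bd]; first exact: Bk.
  rewrite !inE => ad ad' /eqP; rewrite -subr_eq0 -mulrBr => /eqP/Binj.
  by move=> /(_ (chow_degB ad ad'))/eqP; rewrite subr_eq0 => /eqP.
have [N [e [[ed espan] efree]]] := chow_basis Sf k.
have Gunit := gram_unit kd (conj ed espan) efree Bd Binj.
pose x := (\row_j deg (b * e j)) *m invmx (gram e B).
exists (comb e x); first exact: comb_deg.
apply/eqP; rewrite -subr_eq0; apply/eqP; apply: (proj2 (pd kd')) => [|a /espan[y ->]].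
  by apply: chow_degB => //; apply: Bk; exact: comb_deg.
rewrite mulrC (mul_comb (B * comb e x - b)) {1}/comb linear_sum big1 // => j _.
rewrite linearZ /= mulrBl linearB /= -gram_mul_basis /x mulmxKV // mxE subrr.
by rewrite mulr0.
Qed.

Lemma mixed_lefschetz : stars_mixed -> mixed_hard_lefschetz R S d.
Proof.
move=> hstar k kd l lamp; apply: lefschetz_bij => // [|a ad].
  by apply: (@chow_deg_nat_prod _ _ _ _ l 1 (d - k.*2)) => j jM; case: (lamp j jM).
move: (kd); rewrite leq_eqVlt => /orP[/eqP <-|kd1]; last exact: mixed_lefschetz_inj.
by rewrite subnn big_geq // mul1r.
Qed.

Hypothesis hl : mixed_hard_lefschetz R S d.
Hypothesis hr : hodge_riemann d deg.

Lemma hl_inj k (l : nat -> chow R S) a : (k.*2 <= d)%N ->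
  (forall j, (1 <= j <= d - k.*2)%N -> ample (l j)) -> chow_deg R S k a ->
  (\prod_(1 <= j < (d - k.*2).+1) l j) * a = 0 -> a = 0.
Proof.
move=> kd lamp ad a0; have [_ inj _] := hl kd lamp.
by apply: inj; rewrite ?inE ?mulr0 //; exact: chow_deg0.
Qed.

Section Path.
Variables (k : nat) (l : nat -> chow R S).
Hypothesis kd : (k.*2 <= d)%N.
Hypothesis lamp : forall i, (i <= d - k.*2)%N -> ample (l i).
Let m := (d - k.*2)%N.
Let path t i := (1 - t) *: l 0%N + t *: l i.
Let B t := \prod_(1 <= i < m.+1) path t i.

Let path_ample t i : 0 <= t <= 1 -> (i <= m)%N -> ample (path t i).
Proof. by move=> t01 im; apply: ample_convex => //; exact: lamp. Qed.

Let B_deg t : 0 <= t <= 1 -> chow_deg R S m (B t).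
Proof.
move=> t01; apply: (@chow_deg_nat_prod _ _ _ _ (path t) 1 m) => j /andP[_ jm].
by case: (path_ample t01 jm).
Qed.

Lemma path_poly c : exists p : {poly R}, forall t, p.[t] = deg (B t * c).
Proof.
rewrite /B; elim: {+}m c => [|M IH] c.
  by exists (deg c)%:P => t; rewrite hornerC big_geq // mul1r.
have [p pE] := IH (l 0%N * c); have [p' p'E] := IH (l M.+1 * c).
exists ((1 - 'X) * p + 'X * p') => t; rewrite big_nat_recr //= /path.
rewrite !hornerE pE p'E -!mulrA [X in _ = deg (_ * X)]mulrDl [X in _ = deg X]mulrDr.
by rewrite !chow_scaleAl !chow_scaleAr linearD !linearZ.
Qed.

(* [l 0] stays fixed and the other classes move to it; [f] is a basis of      *)
(* [A^(k-1)], empty if [k = 0].                                               *)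
Lemma hodge_riemann_path r (f : 'I_r -> chow R S) :
  (forall j, chow_deg R S k (l 0%N * f j)) ->
  (forall t, 0 <= t <= 1 -> forall y : 'rV_r,
    (forall j, deg (B t * (l 0%N * comb f y) * (l 0%N * f j)) = 0) -> y = 0) ->
  (forall a, chow_deg R S k a -> (forall j, deg (l 0%N ^+ m * a * (l 0%N * f j)) = 0) ->
    l 0%N ^+ m.+1 * a = 0) ->
  forall a, chow_deg R S k a -> (\prod_(0 <= i < m.+1) l i) * a = 0 -> a != 0 ->
  0 < (-1) ^+ k * deg ((\prod_(1 <= i < m.+1) l i) * a * a).
Proof.
move=> fd fW f0 a ad La an0.
have [N [e [[ed espan] efree]]] := chow_basis Sf k.
have /choice[p pE] := path_poly.
pose G : 'M[{poly R}]_N := \matrix_(i, j) ((-1) ^+ k *: p (e i * e j)).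
have GE t : eval_mx t G = (-1) ^+ k *: gram e (B t).
  by apply/matrixP => i j; rewrite !mxE /= /horner_eval hornerZ pE mulrA.
have /choice[W0 W0E] j := espan _ (fd j).
pose W : 'M[R]_(r, N) := \matrix_j W0 j.
have WE j : comb e (row j W) = l 0%N * f j by rewrite rowK W0E.
have sgn0 : (-1) ^+ k != 0 :> R by rewrite expf_neq0 // oppr_eq0 oner_eq0.
have formE t x y : form_at (eval_mx t G) x y = (-1) ^+ k * deg (B t * comb e x * comb e y).
  by rewrite GE /form_at -scalemxAr -scalemxAl mxE -/(form_at _ _ _) form_gram.
have orthE t (x : 'rV_N) : x *m eval_mx t G *m W^T = 0 <->
    forall j, deg (B t * comb e x * (l 0%N * f j)) = 0.
  have WTE j : (x *m eval_mx t G *m W^T) 0 j = (-1) ^+ k * deg (B t * comb e x * (l 0%N * f j)).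
    rewrite -WE -formE /form_at !mxE; apply: eq_bigr => j' _.
    by rewrite !mxE.
  split=> [x0 j|x0]; last by apply/rowP => j; rewrite WTE x0 mulr0 mxE.
  have := WTE j; rewrite x0 mxE => /esym/eqP; rewrite mulf_eq0 (negbTE sgn0).
  by move/eqP.
have Gsym : G^T = G by apply/matrixP => i j; rewrite !mxE mulrC.
have Gunit t : 0 <= t <= 1 -> eval_mx t G \in unitmx.
  move=> t01; rewrite GE unitmxZ ?unitfE //.
  apply: (gram_unit kd) => //; first exact: B_deg.
  by move=> b bd; apply: (hl_inj kd) => // j /andP[_ jm]; exact: path_ample.
have Wunit t : 0 <= t <= 1 -> W *m eval_mx t G *m W^T \in unitmx.
  move=> t01; apply: kermx0_unitmx => y; rewrite !mulmxA => /orthE y0.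
  apply: (fW t t01) => j; rewrite -(y0 j); congr (deg (_ * _ * _)).
  rewrite mul_comb comb_mul; congr (comb _ y); apply: funext => j'.
  by rewrite WE.
have [x aE] := espan a ad.
have x0 : x != 0 by apply: contraNneq an0 => x0; rewrite aE x0 /comb big1 // => j _; rewrite mxE scale0r.
have B0 : B 0 = l 0%N ^+ m.
  rewrite /B (eq_bigr (fun=> l 0%N)) => [|i _]; last first.
    by rewrite /path subr0 scale1r scale0r addr0.
  by rewrite prodr_const_nat subn1.
have B1 : B 1 = \prod_(1 <= i < m.+1) l i.
  by apply: eq_bigr => i _; rewrite /path subrr scale0r scale1r add0r.
have P0 : posdef_orth (eval_mx 0 G) W.
  move=> y /orthE y0 yn0; rewrite formE B0; apply: hr => //; first exact: lamp.
  - exact: comb_deg.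
  - by apply: f0 => [|j]; [exact: comb_deg | rewrite -B0 y0].
  - by apply: contraNneq yn0 => /efree ->.
have := posdef_orth_path Gsym Gunit Wunit P0 (x := x).
rewrite formE B1 -aE; apply => //; apply/orthE => j; rewrite B1 -aE.
move: La; rewrite big_ltn // => La.
by rewrite mulrCA !mulrA La mul0r linear0.
Qed.

End Path.

Lemma mixed_hodge_riemannP : mixed_hodge_riemann d deg.
Proof.
move=> k kd l lamp.
have l0 : ample (l 0%N) by exact: lamp.
have l0d : chow_deg R S 1 (l 0%N) by case: l0.
have l0X M : chow_deg R S M (l 0%N ^+ M).
  elim: M => [|M IH]; first by rewrite expr0; exact: chow_deg1.
  by rewrite exprS; exact: (@chow_degM _ _ _ _ 1).
case: k kd lamp => [|k] kd lamp.
  apply: (hodge_riemann_path kd lamp (r := 0) (f := fun=> 0)) => [[]//|t _ y _|a ad _].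
    by rewrite [y]thinmx0.
  apply: (chow_deg_above Sf (eq_leq dimS)).
  by apply: chow_degE (chow_degM (l0X _) ad) _; rewrite addn0 subn0.
set m := (d - k.+1.*2)%N.
have kd1 : (k.*2 <= d)%N by apply: leq_trans kd; rewrite leq_double.
have mE : (d - k.*2 = m.+2)%N by move: kd; rewrite /m -!addnn; lia.
have [r [f [[fd fspan] ffree]]] := chow_basis Sf k.
have kd' : (k <= d)%N by apply: leq_trans kd1; rewrite -addnn leq_addr.
apply: (hodge_riemann_path kd lamp (f := f)) => [j|t t01 y y0|a ad a0].
- exact: (@chow_degM _ _ _ _ 1).
- apply: ffree; have yd : chow_deg R S k (comb f y) by exact: comb_deg.
  pose l' j := if (j < 3)%N then l 0%N else (1 - t) *: l 0%N + t *: l j.-2.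
  have l'amp j : (1 <= j <= d - k.*2)%N -> ample (l' j).
    rewrite mE /l'; case: (ltnP j 3) => // j3 /andP[_ jm]; apply: ample_convex => //.
    by apply: lamp; rewrite -/m; move: j3 jm; case: j => [|[]].
  apply: (hl_inj kd1 l'amp yd); rewrite mE big_ltn // big_ltn // big_add1 big_add1 /=.
  set Bt := \prod_(1 <= i < _) _ in y0.
  rewrite (_ : \prod_(1 <= i < m.+1) l' i.+2 = Bt); last first.
    by apply: eq_big_nat => -[].
  have Btd : chow_deg R S m Bt.
    apply: (@chow_deg_nat_prod _ _ _ _ _ 1 m) => j /andP[_ jm].
    by case: (ample_convex t01 l0 (lamp j jm)).
  apply: (proj2 (pd kd')) => [|b /fspan[z ->]].
    rewrite -!mulrA; apply: chow_degE (chow_degM l0d (chow_degM l0d (chow_degM Btd yd))) _.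
    by move: kd; rewrite /m -!addnn; lia.
  rewrite mulrC [X in deg X]mul_comb {1}/comb linear_sum big1 // => j _; rewrite linearZ /=.
  rewrite (_ : _ * f j = Bt * (l 0%N * comb f y) * (l 0%N * f j)) ?y0 ?mulr0 //.
  rewrite -!mulrA [RHS]mulrCA; congr (_ * _); rewrite [LHS]mulrCA; congr (_ * _).
  exact: mulrCA.
- apply: (proj2 (pd kd')) => [|b /fspan[z ->]].
    apply: chow_degE (chow_degM (l0X _) ad) _.
    by move: kd; rewrite /m -!addnn; lia.
  rewrite mulrC [X in deg X]mul_comb {1}/comb linear_sum big1 // => j _; rewrite linearZ /=.
  by rewrite exprSr (_ : _ * f j = l 0%N ^+ m * a * (l 0%N * f j)) ?a0 ?mulr0 //; rewrite -!mulrA; congr (_ * _); rewrite mulrCA.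
Qed.

End Mixed.

Lemma mixed_of_stars (R : realType) (I : finType) n (S : fan I n) d :
  simplicial_fan R S -> lefschetz R S d -> stars_mixed R S d ->
  mixed_hard_lefschetz R S d /\
  (forall (w : {set I} -> R) (deg : {scalar chow R S}),
     fundamental_weight S d w -> degree_map d w deg -> mixed_hodge_riemann d deg).
Proof.
move=> Sf /lefschetzP[w [deg [[dimS hw hdeg] [bij pd hr _]]]] stars.
have hl := mixed_lefschetz Sf dimS hw hdeg pd stars.
split=> // w1 deg1 hw1 hdeg1 k kd l lamp a ad La an0.
have [c c0 ->] := degree_ratio Sf dimS hw hdeg bij hw1 hdeg1.
  rewrite mulrCA mulr_gt0 //.
  exact: (mixed_hodge_riemannP Sf dimS pd hl hr kd lamp ad La an0).
have Ld : chow_deg R S (d - k.*2) (\prod_(1 <= i < (d - k.*2).+1) l i).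
  by apply: (@chow_deg_nat_prod _ _ _ _ l 1 (d - k.*2)) => j /andP[_ jm]; case: (lamp j jm).
apply: chow_degE (chow_degM (chow_degM Ld ad) ad) _.
by rewrite -addnA addnn subnK.
Qed.

Theorem theorem5p19 (R : realType) (I : finType) (n : nat) (S : fan I n)
    (d : nat) (S_fan : simplicial_fan R S) (S_lefschetz : lefschetz R S d) :
  mixed_hard_lefschetz R S d /\
  (forall (w : {set I} -> R) (deg : {scalar chow R S}),
     fundamental_weight S d w -> degree_map d w deg ->
     mixed_hodge_riemann d deg).
Proof.
elim: d n S S_fan S_lefschetz => [|d IH] n S Sf SL; apply: mixed_of_stars => // i iS m q hq.
all: have [_ [_ [[dimS _ _] [_ _ _ hstar]]]] := lefschetzP SL.
  by have := cone_dim iS; rewrite dimS cards1.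
have := hstar _ iS _ m q hq; rewrite cards1 subn1 => /(_ isT) L'.
have [w' [deg' [[dim' hw' hdeg'] [bij' pd' _ _]]]] := lefschetzP L'.
exists w', deg'; split; split=> //.
have [_ hr'] := IH _ _ (star_simplicial Sf iS hq) L'.
exact: (hr' w' deg').
Qed.
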